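(* Let $I\subset S$ be a monomial ideal such that $S/I$ is Cohen–Macaulay and $I$ has codimension (height) $2$. Then $I$ is $0$-clean.
   Context: $S=K[x_1,\dots,x_n]$, $K$ a field. For a monomial $u=x_1^{a_1}\cdots x_n^{a_n}$, $\mathrm{supp}(u)=\{i:a_i>0\}$. For an ideal $I$, $\min(I)$ is the set of minimal primes of $I$. A monomial $u\neq 1$ with $u\notin I$ is a cleaner monomial of $I$ if $\min(I+Su)\subseteq\min(I)$. For $k\ge 0$, the class of $k$-clean monomial ideals is defined recursively (smallest class closed under the rule): a proper monomial ideal $I$ is $k$-clean if either $I$ is prime, or $I$ has no embedded primes and there is a cleaner monomial $u$ of $I$ with $|\mathrm{supp}(u)|\le k+1$ such that $I:u$ and $I+Su$ are $k$-clean. *)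

(* Defs.v *)
From HB Require Import structures.
From mathcomp Require Import all_boot all_order all_algebra.
Set Implicit Arguments. Unset Strict Implicit. Unset Printing Implicit Defensive.
Import GRing.Theory.
Local Open Scope ring_scope.

Fixpoint mpoly (K : comNzRingType) (n : nat) : comNzRingType :=
  match n with
  | 0 => K
  | m.+1 => {poly (mpoly K m)}
  end.

(* the variable with index i (the innermost variable has index 0) *)
Fixpoint mvar (K : comNzRingType) (n : nat) (i : nat) : mpoly K n :=
  match n return mpoly K n with
  | 0 => 0
  | m.+1 => if i == m then ('X : {poly (mpoly K m)}) else (mvar K m i)%:P
  end.

Section Defs.
Variables (K : fieldType) (n : nat).
Local Notation S := (mpoly K n).

Definition subI (I J : S -> Prop) := forall f, I f -> J f.

Definition is_ideal (I : S -> Prop) :=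
  [/\ I 0, (forall f g, I f -> I g -> I (f + g)) & (forall f g, I g -> I (f * g))].

Definition is_proper (I : S -> Prop) := is_ideal I /\ ~ I 1.

Definition is_prime (P : S -> Prop) :=
  is_proper P /\ (forall f g, P (f * g) -> P f \/ P g).

Definition monomial (a : 'I_n -> nat) : S := \prod_(i < n) mvar K n i ^+ a i.

Definition supp_size (a : 'I_n -> nat) : nat := #|[pred i : 'I_n | (0 < a i)%N]|.

Definition is_monomial_ideal (I : S -> Prop) :=
  is_ideal I /\
  forall f, I f -> exists (m : nat) (g : 'I_m -> S) (a : 'I_m -> 'I_n -> nat),
      (forall j, I (monomial (a j))) /\ f = \sum_(j < m) g j * monomial (a j).

Definition colon (I : S -> Prop) (u : S) : S -> Prop := fun f => I (f * u).
Definition sumI (I : S -> Prop) (u : S) : S -> Prop :=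
  fun f => exists g h, I g /\ f = g + h * u.

Definition minprime (I P : S -> Prop) :=
  [/\ is_prime P, subI I P &
      forall Q, is_prime Q -> subI I Q -> subI Q P -> subI P Q].

Definition assprime (I P : S -> Prop) :=
  is_prime P /\ exists f : S, forall g, P g <-> I (g * f).

Definition no_embedded (I : S -> Prop) :=
  forall P, assprime I P -> minprime I P.

Definition cleaner (I : S -> Prop) (a : 'I_n -> nat) :=
  [/\ monomial a <> 1, ~ I (monomial a) &
      forall P, minprime (sumI I (monomial a)) P -> minprime I P].

Inductive kclean (k : nat) : (S -> Prop) -> Prop :=
| kclean_prime I : is_monomial_ideal I -> is_prime I -> kclean k I
| kclean_step I (a : 'I_n -> nat) :
    is_monomial_ideal I -> is_proper I -> no_embedded I ->
    cleaner I a -> (supp_size a <= k.+1)%N ->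
    kclean k (colon I (monomial a)) -> kclean k (sumI I (monomial a)) ->
    kclean k I.

Definition prime_chain (c : nat -> S -> Prop) (d : nat) :=
  (forall i, (i <= d)%N -> is_prime (c i)) /\
  (forall i, (i < d)%N -> subI (c i) (c i.+1) /\ ~ subI (c i.+1) (c i)).

Definition chain_over (I : S -> Prop) (d : nat) :=
  exists c, prime_chain c d /\ subI I (c 0%N).
Definition dim_quot (I : S -> Prop) (d : nat) :=
  chain_over I d /\ ~ chain_over I d.+1.

Definition height_ge (P : S -> Prop) (d : nat) :=
  exists c, prime_chain c d /\ (forall f, c d f <-> P f).
Definition height_eq (I : S -> Prop) (h : nat) :=
  (forall P, is_prime P -> subI I P -> height_ge P h) /\
  (exists P, [/\ is_prime P, subI I P & ~ height_ge P h.+1]).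

Definition maxideal : S -> Prop :=
  fun f => exists g : 'I_n -> S, f = \sum_(i < n) g i * mvar K n i.

Fixpoint regseq (I : S -> Prop) (s : seq S) : Prop :=
  match s with
  | [::] => ~ I 1
  | f :: s' => [/\ maxideal f, (forall g, I (g * f) -> I g) & regseq (sumI I f) s']
  end.

Definition depth_quot (I : S -> Prop) (d : nat) :=
  (exists s, size s = d /\ regseq I s) /\ ~ (exists s, size s = d.+1 /\ regseq I s).

(* S/I is Cohen-Macaulay: depth_m(S/I) = dim(S/I) (graded setting) *)
Definition CM_quot (I : S -> Prop) :=
  exists d, dim_quot I d /\ depth_quot I d.

End Defs.

(* Main.v *)
(* Let S/I be Cohen-Macaulay of codimension 2. Since dim S/I >= n - 2, there is
   a regular sequence of length n - 2 on S/I, so the Koszul homology H_3(x; S/I)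
   vanishes, i.e. I has projective dimension at most 1. Choose a minimal set F
   of pairs of generators whose relations generate the multigraded syzygies.
   The vanishing makes F free, hence smaller than the number of generators, so
   the graph F has a leaf u, attached to some v: then v divides lcm(u, w) for
   every other generator w. Iterating yields an order of the generators in which
   each one is a leaf with respect to its successors; such orders survive I : x.
   If v divides u, then u is redundant. Otherwise some variable x has larger
   degree in v than in u, so it divides all generators but u (their gcd is 1);
   then I + x = (x, u) is a complete intersection and x is a cleaner. *)
Require Import Defs.
From mathcomp Require Import all_boot all_order all_algebra.
From mathcomp Require Import boolp.
From mathcomp Require Import zify ring.
Set Implicit Arguments. Unset Strict Implicit. Unset Printing Implicit Defensive.
Import GRing.Theory.
Local Open Scope ring_scope.

(** The Cohen-Macaulay hypothesis is used once, to order the generators. From then on the recursion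
    needs only that order, gcd 1 and properness, so S/(I : x) is never shown to be Cohen-Macaulay.
    The order is defined for lists with redundant entries, because I : x is presented by dividing x
    out of every entry where possible, and this may create redundancy. Free resolutions are avoided.
    H_3(x; S/I) is H_2(x; I), whose part of degree w is the reduced H_1 of the complex of squarefree
    x^s with x^w / x^s in I. A cycle of relations in F is a second syzygy. Minimality of F splits it
    into pieces of degrees w - x_i, and H_1 is the obstruction to correcting these pieces into
    cycles. *)

(** * Coefficients and monomials *)

Notation exps n := {ffun 'I_n -> nat}.

Section Coefficients.
Variable K : fieldType.

(** Exponents are plain functions here because the recursion restricts them along [lift ord_max];
    the outermost variable is the one of index [ord_max]. *)
Fixpoint mcoef (n : nat) : mpoly K n -> ('I_n -> nat) -> K :=
  match n return mpoly K n -> ('I_n -> nat) -> K with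
  | 0 => fun f _ => f
  | m.+1 => fun f w => mcoef (f : {poly mpoly K m})`_(w ord_max)
                             (fun i => w (lift ord_max i))
  end.

Fixpoint mconst (n : nat) : K -> mpoly K n :=
  match n return K -> mpoly K n with
  | 0 => fun c => c
  | m.+1 => fun c => (mconst m c)%:P
  end.

Lemma mcoefD n (f g : mpoly K n) w : mcoef (f + g) w = mcoef f w + mcoef g w.
Proof. by elim: n f g w => [|n IH] //= f g w; rewrite coefD IH. Qed.

Lemma mcoef0 n w : mcoef (0 : mpoly K n) w = 0.
Proof. by elim: n w => [|n IH] //= w; rewrite coef0 IH. Qed.

Lemma mcoefN n (f : mpoly K n) w : mcoef (- f) w = - mcoef f w.
Proof. by apply/eqP; rewrite -addr_eq0 -mcoefD addNr mcoef0. Qed.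

Lemma mcoef_sum n I (r : seq I) (P : pred I) (F : I -> mpoly K n) w :
  mcoef (\sum_(i <- r | P i) F i) w = \sum_(i <- r | P i) mcoef (F i) w.
Proof.
by apply: (big_morph (fun f => mcoef f w)) => [f g|]; rewrite (mcoefD, mcoef0).
Qed.

Lemma mcoef_ext n (f : mpoly K n) : (forall w, mcoef f w = 0) -> f = 0.
Proof.
elim: n f => [|n IH] /= f f0; first exact: (f0 (fun=> 0%N)).
apply/polyP => k; rewrite coef0; apply: IH => w.
have := f0 (fun i => if unlift ord_max i is Some j then w j else k).
rewrite unlift_none; congr (mcoef _ _ = _).
by apply/funext => i; rewrite liftK.
Qed.

Lemma mconstD n c d : mconst n (c + d) = mconst n c + mconst n d.
Proof. by elim: n => [|n IH] //=; rewrite IH polyCD. Qed.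

Lemma mconst0 n : mconst n 0 = 0.
Proof. by elim: n => [|n IH] //=; rewrite IH. Qed.

Lemma mconstN n c : mconst n (- c) = - mconst n c.
Proof. by elim: n => [|n IH] //=; rewrite IH polyCN. Qed.

Lemma mcoefCM n c (f : mpoly K n) w : mcoef (mconst n c * f) w = c * mcoef f w.
Proof. by elim: n f w => [|n IH] //= f w; rewrite coefCM IH. Qed.

Lemma mcoef1 n w : mcoef (1 : mpoly K n) w = [forall i, w i == 0%N]%:R.
Proof.
elim: n w => [|n IH] /= w; first by case: forallP => // -[] [].
rewrite coef1; case: eqP => [w0|w0]; last first.
  by rewrite mcoef0; case: forallP => // /(_ ord_max) /eqP.
rewrite IH; congr (_%:R); congr nat_of_bool.
apply/forallP/forallP => w0' i //.
by case: (unliftP ord_max i) => [j ->|->] //; apply/eqP.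
Qed.

Lemma mcoefXM n (i : 'I_n) (f : mpoly K n) w :
  mcoef (mvar K n i * f) w
  = if w i == 0%N then 0 else mcoef f (fun j => (w j - (i == j))%N).
Proof.
elim: n i f w => [|n IH] /= i f w; first by case: i.
case: (unliftP ord_max i) => [j|] -> /=.
  rewrite [bump n j](_ : _ = j :> nat) /bump; last by rewrite leqNgt ltn_ord.
  rewrite ltn_eqF ?ltn_ord // coefCM IH; case: ifP => // _.
  rewrite [lift _ _ == _]eq_sym (negbTE (neq_lift _ _)) subn0.
  congr (mcoef _ _); apply/funext => k.
  by rewrite (inj_eq lift_inj).
rewrite eqxx coefXM; case: eqP => _; first by rewrite mcoef0.
rewrite eqxx subn1; congr (mcoef _ _); apply/funext => k.
by rewrite (negbTE (neq_lift _ _)) subn0.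
Qed.

(** Lets closure properties of ideals be proved without unfolding the nested polynomial rings. *)
Lemma mpoly_ind n (P : mpoly K n -> Prop) :
  (forall c, P (mconst n c)) -> (forall f g, P f -> P g -> P (f + g)) ->
  (forall (i : 'I_n) f, P f -> P (mvar K n i * f)) -> forall f, P f.
Proof.
elim: n P => [|n IH] /= P PC PD PX; first exact: PC.
have PP : forall f : mpoly K n, P f%:P.
  apply: (IH (fun f => P f%:P)) => // [f g Pf Pg|i f Pf]; first by rewrite polyCD; apply: PD.
  have := PX (lift ord_max i) _ Pf; rewrite /= /bump leqNgt ltn_ord add0n.
  by rewrite ltn_eqF ?ltn_ord // polyCM.
elim/poly_ind => [|p c Pp]; first exact: (PP 0).
apply: PD => //; rewrite commr_polyX.
by have := PX ord_max _ Pp; rewrite /= eqxx.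
Qed.

Lemma mcoefXnM n (i : 'I_n) k (f : mpoly K n) w :
  mcoef (mvar K n i ^+ k * f) w
  = if (k <= w i)%N then mcoef f (fun j => (w j - (i == j) * k)%N) else 0.
Proof.
elim: k w => [|k IH] w.
  by rewrite expr0 mul1r; congr (mcoef _ _); apply/funext => j; rewrite muln0 subn0.
rewrite exprS -mulrA mcoefXM IH eqxx; case: eqP => [->//|/eqP wi].
rewrite -ltnS subn1 prednK ?lt0n //; case: ifP => // _.
by congr (mcoef _ _); apply/funext => j; case: (i == j) => /=; lia.
Qed.

Definition mle n (a b : 'I_n -> nat) := [forall i, a i <= b i]%N.
Definition madd n (a b : 'I_n -> nat) : exps n := [ffun i => a i + b i]%N.
Definition msub n (a b : 'I_n -> nat) : exps n := [ffun i => a i - b i]%N.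
Definition munit n (i : 'I_n) : exps n := [ffun j => (i == j) : nat].
Definition mzero n : exps n := [ffun=> 0%N].

Lemma mleP n (a b : 'I_n -> nat) : reflect (forall i, (a i <= b i)%N) (mle a b).
Proof. exact: forallP. Qed.

Lemma mle_refl n (a : 'I_n -> nat) : mle a a.
Proof. by apply/mleP. Qed.

Lemma mle_trans n (b a c : 'I_n -> nat) : mle a b -> mle b c -> mle a c.
Proof. by move=> /mleP ab /mleP bc; apply/mleP => i; apply: leq_trans (bc i). Qed.

Lemma munit_le n (i : 'I_n) (w : 'I_n -> nat) : mle (munit i) w = (0 < w i)%N.
Proof.
apply/mleP/idP => [/(_ i)|wi j]; rewrite ffunE ?eqxx //.
by case: eqP => [<-|].
Qed.

Lemma mcoef_monomialM n a (f : mpoly K n) w :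
  mcoef (monomial K a * f) w = if mle a w then mcoef f (msub w a) else 0.
Proof.
suff H (r : seq 'I_n) : uniq r -> mcoef (\prod_(i <- r) mvar K n i ^+ a i * f) w
   = if all (fun i => a i <= w i)%N r
     then mcoef f (fun j => w j - (j \in r) * a j)%N else 0.
  rewrite /monomial H ?index_enum_uniq //.
  have -> : all (fun i => (a i <= w i)%N) (index_enum 'I_n) = mle a w.
    by apply/allP/mleP => [h i|h i _]; apply: h; rewrite ?mem_index_enum.
  case: ifP => // _; congr (mcoef _ _); apply/funext => j.
  by rewrite mem_index_enum mul1n ffunE.
elim: r w => [|i r IH] w /=.
  by rewrite big_nil mul1r => _; congr (mcoef _ _); apply/funext => j; rewrite subn0.
case/andP=> ir ur; rewrite big_cons -mulrA mcoefXnM IH // andbC.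
have -> : all (fun j => a j <= w j - (i == j) * a i)%N r = all (fun j => a j <= w j)%N r.
  by apply: eq_in_all => j jr; case: eqP => [ij|]; rewrite ?subn0 // ij jr in ir *.
case: (all _ r); rewrite ?(andbT, andbF); case: (leqP (a i) (w i)) => _ //.
congr (mcoef _ _); apply/funext => j; rewrite inE [j == i]eq_sym; case: eqP => [<-|_] /=; last by rewrite subn0.
by rewrite (negbTE ir) subn0.
Qed.

Lemma mcoef_monomial n (a w : exps n) : mcoef (monomial K a) w = (a == w)%:R.
Proof.
rewrite -[monomial K a]mulr1 mcoef_monomialM mcoef1.
case: (boolP (mle a w)) => [/mleP aw|aw]; last first.
  by case: eqP aw => // ->; rewrite mle_refl.
congr (_%:R); congr nat_of_bool; apply/forallP/eqP => [h|-> i]; last by rewrite ffunE subnn.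
by apply/ffunP => i; apply/eqP; rewrite eqn_leq aw -subn_eq0; have := h i; rewrite ffunE.
Qed.

Lemma mpoly_ext n (f g : mpoly K n) : (forall w : exps n, mcoef f w = mcoef g w) -> f = g.
Proof.
move=> fg; apply/eqP; rewrite -subr_eq0; apply/eqP; apply: mcoef_ext => w.
have -> : w = [ffun i => w i] by apply/funext => i; rewrite ffunE.
by rewrite mcoefD mcoefN fg subrr.
Qed.

Lemma monomialD n (a b : 'I_n -> nat) :
  monomial K (madd a b) = monomial K a * monomial K b.
Proof. by rewrite -big_split; apply: eq_bigr => i _; rewrite ffunE exprD. Qed.

Lemma monomial0 n : monomial K (mzero n) = 1.
Proof. by rewrite /monomial big1 // => i _; rewrite ffunE. Qed.

Lemma monomial_unit n (i : 'I_n) : monomial K (munit i) = mvar K n i.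
Proof.
rewrite /monomial (bigD1 i) //= big1 ?mulr1 ?ffunE ?eqxx // => j ji.
by rewrite ffunE eq_sym (negbTE ji).
Qed.

Lemma maddC n (a b : 'I_n -> nat) : madd a b = madd b a.
Proof. by apply/ffunP => i; rewrite !ffunE addnC. Qed.

Lemma madd0 n (a : exps n) : madd a (mzero n) = a.
Proof. by apply/ffunP => i; rewrite !ffunE addn0. Qed.

Lemma maddKB n (a : 'I_n -> nat) (b : exps n) : msub (madd a b) a = b.
Proof. by apply/ffunP => i; rewrite !ffunE addKn. Qed.

Lemma msubK n (a : 'I_n -> nat) (b : exps n) : mle a b -> madd a (msub b a) = b.
Proof. by move/mleP=> ab; apply/ffunP => i; rewrite !ffunE subnKC. Qed.

Lemma mle_add n (a b : 'I_n -> nat) : mle a (madd a b).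
Proof. by apply/mleP => i; rewrite ffunE leq_addr. Qed.

Lemma mle_addr n (a b : 'I_n -> nat) : mle a (madd b a).
Proof. by rewrite maddC mle_add. Qed.

Lemma mcoef_finite n (f : mpoly K n) :
  exists r : seq (exps n), forall w : exps n, mcoef f w != 0 -> w \in r.
Proof.
elim/mpoly_ind: f => [c|f g [r Hr] [s Hs]|i f [r Hr]].
- exists [:: mzero n] => w; rewrite -[mconst n c]mulr1 mcoefCM mcoef1.
  case: forallP => [w0 _|]; last by rewrite mulr0 eqxx.
  by rewrite inE; apply/eqP/ffunP => i; rewrite ffunE; apply/eqP.
- exists (r ++ s) => w; rewrite mcoefD mem_cat.
  case: (eqVneq (mcoef f w) 0) => [f0|/Hr -> //].
  case: (eqVneq (mcoef g w) 0) => [g0|/Hs -> _]; last by rewrite orbT.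
  by rewrite f0 g0 addr0 eqxx.
- exists ([seq madd (munit i) (a : exps n) | a : exps n <- r]) => w.
  rewrite -monomial_unit mcoef_monomialM; case: ifP; rewrite ?eqxx // => iw /Hr wr.
  by apply/mapP; exists (msub w (munit i)) => //; rewrite msubK.
Qed.

Lemma mcoef_expand n (f : mpoly K n) : exists2 r : seq (exps n), uniq r &
  f = \sum_(a <- r) mconst n (mcoef f a) * monomial K a.
Proof.
have [r Hr] := mcoef_finite f; exists (undup r); first exact: undup_uniq.
apply: mpoly_ext => w; rewrite mcoef_sum.
rewrite (eq_bigr (fun a : exps n => if a == w then mcoef f a else 0)); last first.
  by move=> a _; rewrite mcoefCM mcoef_monomial; case: eqP; rewrite (mulr1, mulr0).
case: (boolP (w \in undup r)) => [wr|].
  by rewrite (bigD1_seq w) ?undup_uniq //= eqxx big1 ?addr0 // => a /negbTE ->.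
rewrite mem_undup => wr; rewrite big1_seq; last first.
  by move=> a /=; rewrite mem_undup; case: eqP wr => // -> /negbTE ->.
by apply/eqP; apply: contraR wr => /Hr.
Qed.

End Coefficients.

(** * Monomial ideals and monomial primes *)

Section MonomialIdeals.
Variable K : fieldType.

Definition upset n (U : exps n -> Prop) := forall a b : exps n, U a -> mle a b -> U b.

(** For an upset [U] this is the monomial ideal spanned by the monomials with exponent in [U].
    Colons and sums by a monomial thus become operations on sets of exponents. *)
Definition mid n (U : exps n -> Prop) (f : mpoly K n) :=
  forall w : exps n, mcoef f w != 0 -> U w.

Lemma mcoef_ffun n (f : mpoly K n) (w : 'I_n -> nat) :
  mcoef f w = mcoef f ([ffun i => w i] : exps n).
Proof. by congr (mcoef _ _); apply/funext => i; rewrite ffunE. Qed.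

Lemma mid_ideal n (U : exps n -> Prop) : upset U -> is_ideal (mid U).
Proof.
move=> upU.
have midD f g : mid U f -> mid U g -> mid U (f + g).
  move=> Uf Ug w; rewrite mcoefD; case: (eqVneq (mcoef f w) 0) => [->|/Uf Uw _ //].
  by rewrite add0r => /Ug.
split=> // [w|f g]; first by rewrite mcoef0 eqxx.
elim/mpoly_ind: f => [c|f f' IHf IHf'|i f IHf] Ug.
- by move=> w; rewrite mcoefCM mulf_eq0 negb_or => /andP[_ /Ug].
- by rewrite mulrDl; apply: midD; [apply: IHf|apply: IHf'].
- move=> w; rewrite -mulrA -monomial_unit mcoef_monomialM.
  case: ifP => [iw|]; rewrite ?eqxx // => /(IHf Ug) /upU; apply.
  by apply/mleP => j; rewrite ffunE leq_subr.
Qed.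

Lemma mid_monomial n (U : exps n -> Prop) (a : exps n) : mid U (monomial K a) <-> U a.
Proof.
split=> [|Ua w]; first by apply; rewrite mcoef_monomial eqxx oner_eq0.
by rewrite mcoef_monomial; case: (a =P w) => [<-//|_]; rewrite eqxx.
Qed.

Section IdealClosure.
Variables (n : nat) (I : mpoly K n -> Prop).
Hypothesis idI : is_ideal I.

Lemma ideal0 : I 0. Proof. by case: idI. Qed.
Lemma idealD f g : I f -> I g -> I (f + g). Proof. by case: idI => _ + _; apply. Qed.
Lemma idealM f g : I g -> I (f * g). Proof. by case: idI => _ _; apply. Qed.
Lemma idealMr f g : I f -> I (f * g). Proof. by rewrite mulrC; apply: idealM. Qed.
Lemma idealN f : I f -> I (- f). Proof. by rewrite -mulN1r; apply: idealM. Qed.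
Lemma idealB f g : I f -> I g -> I (f - g).
Proof. by move=> If Ig; apply/idealD/idealN. Qed.
Lemma ideal_sum J (r : seq J) (P : pred J) F :
  (forall j, P j -> I (F j)) -> I (\sum_(j <- r | P j) F j).
Proof. by move=> IF; apply: big_ind => //; [exact: ideal0 | exact: idealD]. Qed.
End IdealClosure.

Lemma eq_ideal n (I J : mpoly K n -> Prop) :
  (forall f, I f <-> J f) -> is_ideal J -> is_ideal I.
Proof. by move=> IJ [J0 JD JM]; split=> [|f g|f g]; rewrite !IJ; auto. Qed.

Lemma monomial_ideal_mid n (I : mpoly K n -> Prop) : is_monomial_ideal I ->
  upset (fun w : exps n => I (monomial K w)) /\
  forall f, I f <-> mid (fun w : exps n => I (monomial K w)) f.
Proof.
case=> idI genI.
have upI : upset (fun w : exps n => I (monomial K w)).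
  by move=> a b Ia ab; rewrite -(msubK ab) monomialD; apply: (idealMr idI).
split=> // f; split=> [/genI[m [g [a [Ia ->]]]]|If].
  have idM := mid_ideal upI.
  apply: (ideal_sum idM) => j _; apply: (idealM idM).
  have -> : monomial K (a j) = monomial K ([ffun i => a j i] : exps n).
    by apply: eq_bigr => i _; rewrite ffunE.
  apply/mid_monomial; rewrite (_ : monomial _ _ = monomial K (a j)) //.
  by apply: eq_bigr => i _; rewrite ffunE.
have [r _ Ef] := mcoef_expand f; rewrite Ef; apply: (ideal_sum idI) => a _.
case: (eqVneq (mcoef f a) 0) => [->|/If Ia]; last exact: (idealM idI).
by rewrite mconst0 mul0r; apply: (ideal0 idI).
Qed.

(** The part in [V] is returned as an explicit list of terms, so that each term can then be factored
    or used as a generator. *)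
Lemma mid_split n (U V : exps n -> Prop) f : mid (fun w => U w \/ V w) f ->
  exists g (r : seq (exps n)),
    [/\ mid U g, forall a, a \in r -> V a &
     f = g + \sum_(a <- r) mconst n (mcoef f a) * monomial K a].
Proof.
move=> UVf; have [r _ Ef] := mcoef_expand f.
pose p (a : exps n) := `[< U a >].
pose q (a : exps n) := ~~ p a && (mcoef f a != 0).
exists (\sum_(a <- r | p a) mconst n (mcoef f a) * monomial K a), (filter q r).
split=> [w|a|].
- rewrite mcoef_sum; case: (boolP (p w)) => [/asboolP //|pw].
  rewrite big1 ?eqxx // => a pa; rewrite mcoefCM mcoef_monomial.
  by case: eqP pw => [<-|]; rewrite ?pa ?mulr0.
- by rewrite mem_filter => /andP[/andP[/asboolP pa /UVf []]].
- rewrite {1}Ef (bigID p) /=; congr (_ + _); rewrite big_filter.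
  rewrite (bigID (fun a : exps n => mcoef f a != 0)) /= addrC big1 ?add0r //.
  by move=> a /andP[_ /negPn/eqP ->]; rewrite mconst0 mul0r.
Qed.

Lemma mid_is_monomial_ideal n (U : exps n -> Prop) (I : mpoly K n -> Prop) :
  upset U -> (forall f, I f <-> mid U f) -> is_monomial_ideal I.
Proof.
move=> upU IU; split; first exact: eq_ideal IU (mid_ideal upU).
move=> f /IU Uf.
have /mid_split[g [r [g0 rU Ef]]] : mid (fun w : exps n => False \/ U w) f.
  by move=> w /Uf; right.
have {}g0 : g = 0.
  apply: mpoly_ext => w; rewrite mcoef0; apply/eqP/negPn/negP => /g0 //.
exists (size r), (fun j => mconst n (mcoef f (nth (mzero n) r j))),
  (fun j => nth (mzero n) r j); split=> [j|].
  by apply/IU/mid_monomial/rU/mem_nth.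
by rewrite {1}Ef g0 add0r (big_nth (mzero n)) big_mkord.
Qed.

Lemma colon_mid n (U : exps n -> Prop) (a : exps n) f :
  mid U (f * monomial K a) <-> mid (fun w => U (madd a w)) f.
Proof.
rewrite mulrC; split=> Uf w.
  by move=> fw; apply: Uf; rewrite mcoef_monomialM mle_add maddKB.
rewrite mcoef_monomialM; case: ifP; rewrite ?eqxx // => aw /Uf.
by rewrite msubK.
Qed.

Lemma sumI_mid n (U : exps n -> Prop) (a : exps n) f : upset U ->
  sumI (mid U) (monomial K a) f <-> mid (fun w => U w \/ mle a w) f.
Proof.
move=> upU; split=> [[g [h [Ug ->]]] w|].
  rewrite mcoefD; case: (eqVneq (mcoef g w) 0) => [->|/Ug]; last by left.
  by rewrite add0r mulrC mcoef_monomialM; case: ifP; rewrite ?eqxx //; right.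
case/mid_split=> g [r [Ug ra Ef]].
exists g, (\sum_(w <- r) mconst n (mcoef f w) * monomial K (msub w a)).
split=> //; rewrite {1}Ef mulr_suml; congr (_ + _).
rewrite !big_seq; apply: eq_bigr => w /ra aw.
by rewrite -mulrA -monomialD maddC msubK.
Qed.

Lemma eq_sumI n (I J : mpoly K n -> Prop) u f :
  (forall f, I f <-> J f) -> sumI I u f <-> sumI J u f.
Proof. by move=> IJ; split=> -[g [h [/IJ Ig ->]]]; exists g, h. Qed.

(** The prime ideal generated by the variables indexed by [A]. *)
Definition varI n (A : {set 'I_n}) : mpoly K n -> Prop :=
  mid (fun w => exists2 i, i \in A & (0 < w i)%N).

Lemma varU_upset n (A : {set 'I_n}) :
  upset (fun w : exps n => exists2 i, i \in A & (0 < w i)%N).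
Proof. by move=> a b [i iA ai] /mleP ab; exists i => //; apply: leq_trans (ab i). Qed.

Lemma varI_monomial n (A : {set 'I_n}) (a : exps n) :
  varI A (monomial K a) <-> exists2 i, i \in A & (0 < a i)%N.
Proof. exact: mid_monomial. Qed.

Lemma varI_var n (A : {set 'I_n}) (i : 'I_n) : varI A (mvar K n i) <-> i \in A.
Proof.
rewrite -monomial_unit varI_monomial; split=> [[j jA]|iA].
  by rewrite ffunE; case: eqP => // ->.
by exists i; rewrite // ffunE eqxx.
Qed.

Lemma varI_ideal n (A : {set 'I_n}) : is_ideal (varI A).
Proof. exact/mid_ideal/varU_upset. Qed.

(* A product avoiding the ideal is found, in the last variable, by multiplying
   the lowest coefficients of the two factors that avoid it. *)
Lemma varI_mul n (A : {set 'I_n}) (f g : mpoly K n) :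
  varI A (f * g) -> varI A f \/ varI A g.
Proof.
elim: n A f g => [|n IH] A f g /=.
  move=> fg; case: (eqVneq (f : K) 0) => [f0|f0]; first by left=> w /=; rewrite f0 eqxx.
  case: (eqVneq (g : K) 0) => [g0|g0]; first by right=> w /=; rewrite g0 eqxx.
  by case: (fg (mzero 0)) => [|[]//]; rewrite /= mulf_neq0.
pose A' := [set i | lift ord_max i \in A].
have idA' := varI_ideal A'.
pose ext (w : exps n) k : exps n.+1 :=
  [ffun i => if unlift ord_max i is Some j then w j else k].
have extE (h : {poly mpoly K n}) w k : mcoef (h : mpoly K n.+1) (ext w k) = mcoef h`_k w.
  rewrite /= ffunE unlift_none; congr (mcoef _ _).
  by apply/funext => i; rewrite ffunE liftK.
have coefA (h : {poly mpoly K n}) : (forall k, varI A' h`_k) -> varI A (h : mpoly K n.+1).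
  move=> hA w /=; rewrite mcoef_ffun => /hA[i]; rewrite inE ffunE => iA wi.
  by exists (lift ord_max i).
case: (boolP (ord_max \in A)) => maxA.
  have coef0A (h : {poly mpoly K n}) : varI A (h : mpoly K n.+1) <-> varI A' h`_0.
    split=> hA w.
      rewrite -extE => /hA[i iA]; rewrite ffunE; case: unliftP => [j Ej wj|]//.
      by exists j; rewrite // inE -Ej.
    rewrite /=; case: (posnP (w ord_max)) => [->|wm _]; last by exists ord_max.
    by rewrite mcoef_ffun => /hA[i]; rewrite inE ffunE; exists (lift ord_max i).
  by rewrite !coef0A coef0M => /IH.
have {}coefA (h : {poly mpoly K n}) : varI A (h : mpoly K n.+1) <-> forall k, varI A' h`_k.
  split=> [hA k w|]; last exact: coefA.
  rewrite -extE => /hA[i iA]; rewrite ffunE; case: unliftP => [j Ej wj|Ei]//.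
    by exists j; rewrite // inE -Ej.
  by rewrite -Ei iA in maxA.
rewrite !coefA => fgA.
case: (pselect (exists k, `[< ~ varI A' (f : {poly mpoly K n})`_k >])) => [exf|nf]; last first.
  by left=> k; apply: contrapT => fk; apply: nf; exists k; apply/asboolP.
case: (pselect (exists k, `[< ~ varI A' (g : {poly mpoly K n})`_k >])) => [exg|ng]; last first.
  by right=> k; apply: contrapT => gk; apply: ng; exists k; apply/asboolP.
case: (ex_minnP exf) => i /asboolP fi mini; case: (ex_minnP exg) => j /asboolP gj minj.
have := fgA (i + j)%N; rewrite coefM.
have lti : (i < (i + j).+1)%N by rewrite ltnS leq_addr.
rewrite (bigD1 (Ordinal lti)) //= addKn => fgij.
suff /IH[] : varI A' ((f : {poly mpoly K n})`_i * (g : {poly mpoly K n})`_j) by [].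
rewrite -[_ * _](addrK (\sum_(k < (i + j).+1 | k != Ordinal lti)
   (f : {poly mpoly K n})`_k * (g : {poly mpoly K n})`_(i + j - k))).
apply: (idealB idA') => //; apply: (ideal_sum idA') => k ki.
have {}ki : k != i :> nat by apply: contra ki => /eqP ki; apply/eqP/val_inj.
case: (ltnP k i) => [lki|lik].
  apply: (idealMr idA'); apply: contrapT => fk.
  by move: lki; rewrite ltnNge mini //; apply/asboolP.
apply: (idealM idA'); apply: contrapT => gk.
have : (i + j - k < j)%N by have := ltn_ord k; lia.
by rewrite ltnNge minj //; apply/asboolP.
Qed.

Lemma varI_prime n (A : {set 'I_n}) : is_prime (varI A).
Proof.
split; last exact: varI_mul.
split; first exact: varI_ideal.
by rewrite -monomial0 => /varI_monomial[i _]; rewrite ffunE.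
Qed.

Lemma varIS n (A B : {set 'I_n}) : subI (varI A) (varI B) <-> A \subset B.
Proof.
split=> [AB|AB f Af w /Af[i iA wi]]; last by exists i; rewrite // (subsetP AB).
by apply/subsetP => i /varI_var/AB/varI_var.
Qed.

Lemma prime_monomial n (P : mpoly K n -> Prop) (a : 'I_n -> nat) :
  is_prime P -> P (monomial K a) -> exists2 i, (0 < a i)%N & P (mvar K n i).
Proof.
case=> -[idP P1] mulP; rewrite /monomial.
elim: (index_enum _) => [|i r IH]; rewrite ?big_nil ?big_cons // => /mulP[|//].
move: (leqnn (a i)); elim: {1 3}(a i) => [|k IHk] ka; first by rewrite expr0.
by rewrite exprS => /mulP[|/IHk]; [exists i; rewrite // (leq_trans _ ka)|apply; apply: ltnW].
Qed.

(** A monomial in a prime has a variable in that prime, so the variables of [P] already generate a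
    prime over the monomial ideal. This reduces questions about arbitrary primes to sets of
    variables. *)
Lemma prime_mid_varI n (P : mpoly K n -> Prop) (U : exps n -> Prop) :
  upset U -> is_prime P -> subI (mid U) P ->
  exists A : {set 'I_n}, subI (mid U) (varI A) /\ forall i, i \in A <-> P (mvar K n i).
Proof.
move=> upU prP UP; exists [set i : 'I_n | `[< P (mvar K n i) >]]; split=> [f Uf w /Uf Uw|i].
  have /UP/(prime_monomial prP)[i wi Pi] := (mid_monomial U w).2 Uw.
  by exists i; rewrite // inE; apply/asboolP.
by rewrite inE asboolE.
Qed.

Lemma varI_sub n (A : {set 'I_n}) (P : mpoly K n -> Prop) :
  is_ideal P -> (forall i, i \in A -> P (mvar K n i)) -> subI (varI A) P.
Proof.
move=> idP AP f Af; have [r _ Ef] := mcoef_expand f; rewrite Ef.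
apply: (ideal_sum idP) => a _; case: (eqVneq (mcoef f a) 0) => [->|/Af[i iA ai]].
  by rewrite mconst0 mul0r; apply: (ideal0 idP).
rewrite -[a](@msubK _ (munit i)) ?munit_le // monomialD monomial_unit mulrCA.
by apply: (idealMr idP); apply: AP.
Qed.

(** Dickson's lemma, by induction on the list of coordinates that are compared. *)
Lemma dickson n (U : exps n -> Prop) : exists us : seq (exps n),
  (forall u, u \in us -> U u) /\
  forall w, U w -> exists2 u, u \in us & mle u w.
Proof.
suff H (l : seq 'I_n) (V : exps n -> Prop) : exists us : seq (exps n),
    (forall u, u \in us -> V u) /\
    forall w, V w -> exists2 u, u \in us & all (fun i => u i <= w i)%N l.
  have [us [usU Uus]] := H (enum 'I_n) U; exists us; split=> // w /Uus[u uus /allP uw].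
  by exists u => //; apply/mleP => i; apply: uw; rewrite mem_enum.
elim: l V => [|i l IH] V.
  case: (pselect (exists w, V w)) => [[w Vw]|nV].
    by exists [:: w]; split=> [u|v _]; [rewrite inE => /eqP ->|exists w; rewrite ?inE].
  by exists [::]; split=> // w Vw; case: nV; exists w.
have [us0 [us0V Vus0]] := IH V.
(* [us0] was found by ignoring coordinate i. Above the bound N it also dominates in that coordinate;
   the finitely many slices below N are treated one by one. *)
pose N := \max_(u <- us0) (u : exps n) i.
suff [us [usV Vus]] : exists us : seq (exps n), (forall u, u \in us -> V u) /\
    forall w, V w -> (w i < N)%N -> exists2 u, u \in us & all (fun j => u j <= w j)%N (i :: l).
  exists (us0 ++ us); split=> [u|w Vw].
    by rewrite mem_cat => /orP[/us0V|/usV].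
  case: (ltnP (w i) N) => [/(Vus _ Vw)[u uus uw]|Nw].
    by exists u; rewrite // mem_cat uus orbT.
  have [u uus uw] := Vus0 _ Vw; exists u; rewrite ?mem_cat ?uus //= uw andbT.
  by apply: leq_trans Nw; rewrite /N (big_rem u) //= leq_maxl.
elim: N => [|N [us [usV Vus]]]; first by exists [::].
have [us1 [us1V Vus1]] := IH (fun w => V w /\ w i = N).
exists (us ++ us1); split=> [u|w Vw].
  by rewrite mem_cat => /orP[/usV|/us1V[]].
rewrite ltnS leq_eqVlt => /orP[/eqP wN|/(Vus _ Vw)[u uus uw]]; last first.
  by exists u; rewrite // mem_cat uus.
have [u uus uw] := Vus1 w (conj Vw wN); exists u; rewrite ?mem_cat ?uus ?orbT //=.
by rewrite uw andbT; have [_ ->] := us1V _ uus; rewrite wN.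
Qed.

End MonomialIdeals.

(** * Koszul homology *)

Section Koszul.
Variables (n : nat) (R : comNzRingType).
Implicit Types (z : seq 'I_n -> R) (x g : 'I_n -> R) (s p : seq 'I_n).

(* Elements of the j-th Koszul module are represented by the restriction to the
   sequences of size j of an alternating function. *)
Definition alternating z := forall p i j s,
  z (p ++ i :: j :: s) = - z (p ++ j :: i :: s) /\ z (p ++ i :: i :: s) = 0.

Definition kdiff x z s := \sum_i x i * z (i :: s).

(** Exterior multiplication by g, expanded along the first index; by [kdiff_khom] it is a null
    homotopy of multiplication by sum_i g_i x_i. *)
Fixpoint khom g z s : R :=
  if s is i :: s' then g i * z s' - khom g (fun t => z (i :: t)) s' else 0.

(** In characteristic 2 antisymmetry does not force a zero diagonal, so this is asked for
    separately. The induction removes one row together with its column. *)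
Lemma sum_antisym (r : seq 'I_n) (a : 'I_n -> 'I_n -> R) :
  (forall i j, a i j = - a j i) -> (forall i, a i i = 0) ->
  \sum_(i <- r) \sum_(j <- r) a i j = 0.
Proof.
move=> aN a0; elim: r => [|k r IH]; first by rewrite big_nil.
under eq_bigr do rewrite big_cons.
rewrite big_cons big_split /= IH a0 add0r addr0.
by under [X in X + _]eq_bigr do rewrite aN; rewrite sumrN addNr.
Qed.

Lemma alternating_cons z i : alternating z -> alternating (fun t => z (i :: t)).
Proof. by move=> altz p j k s; exact: (altz (i :: p)). Qed.

Lemma alternating_notuniq z s : alternating z -> ~~ uniq s -> z s = 0.
Proof.
elim: s z => [|i s IH] //= z altz; rewrite negb_and negbK => /orP[|us]; last first.
  exact: (IH _ (alternating_cons i altz)).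
clear IH; elim: s z altz => [|j s IH] // z altz; rewrite inE => /orP[/eqP <-|iins].
  by have [] := altz [::] i i s.
have [-> _] := altz [::] i j s.
by rewrite /= (IH (fun t => z (j :: t))) ?oppr0 //; apply: alternating_cons.
Qed.

Lemma eq_khom g z z' s : z =1 z' -> khom g z s = khom g z' s.
Proof.
elim: s z z' => [|i s IH] //= z z' zz'; rewrite zz'; congr (_ - _).
by apply: IH => t.
Qed.

Lemma khom_sum g (z : 'I_n -> seq 'I_n -> R) s :
  khom g (fun t => \sum_i z i t) s = \sum_i khom g (z i) s.
Proof.
elim: s z => [|i s IH] //= z; first by rewrite big1.
by rewrite IH mulr_sumr -sumrB.
Qed.

Lemma khomZ g c z s : khom g (fun t => c * z t) s = c * khom g z s.
Proof.
elim: s z => [|i s IH] //= z; first by rewrite mulr0.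
by rewrite IH mulrBr mulrCA.
Qed.

Lemma khom0 g s : khom g (fun=> 0) s = 0.
Proof. by elim: s => [|i s IH] //=; rewrite IH mulr0 subr0. Qed.

Lemma khomN g z s : khom g (fun t => - z t) s = - khom g z s.
Proof. by under eq_khom do rewrite -mulN1r; rewrite khomZ mulN1r. Qed.

Lemma alternating_khom g z : alternating z -> alternating (khom g z).
Proof.
move=> + p; elim: p z => [|k p IH] z altz i j s /=.
  split.
    rewrite (@eq_khom _ (fun t => z (i :: j :: t)) (fun t => - z (j :: i :: t))).
      by rewrite khomN; ring.
    by move=> t; have [] := altz [::] i j t.
  rewrite (@eq_khom _ _ (fun=> 0)); first by rewrite khom0; ring.
  by move=> t; have [] := altz [::] i i t.
have [-> ->] := IH _ (alternating_cons k altz) i j s.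
have [-> _] := altz p i j s; have [_ ->] := altz p i i s.
by rewrite mulr0 subr0 mulrN opprD !opprK; split.
Qed.

Lemma alternating_kdiff x z : alternating z -> alternating (kdiff x z).
Proof.
move=> altz p i j s; split.
  by rewrite -sumrN; apply: eq_bigr => k _; rewrite -mulrN; have [-> _] := altz (k :: p) i j s.
by apply: big1 => k _; have [_ /= ->] := altz (k :: p) i i s; rewrite mulr0.
Qed.

Lemma kdiff_kdiff x z s : alternating z -> kdiff x (kdiff x z) s = 0.
Proof.
move=> altz; under [LHS]eq_bigr do rewrite mulr_sumr.
apply: sum_antisym => [i j|i].
  by have [/= -> _] := altz [::] j i s; rewrite !mulrN mulrCA.
by have [_ /= ->] := altz [::] i i s; rewrite !mulr0.
Qed.

Lemma kdiff_khom x g z s :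
  kdiff x (khom g z) s = (\sum_i g i * x i) * z s - khom g (kdiff x z) s.
Proof.
rewrite khom_sum mulr_suml -sumrB; apply: eq_bigr => i _ /=.
by rewrite khomZ mulrBr mulrA [x i * g i]mulrC.
Qed.

Lemma kdiffB x z z' s : kdiff x (fun t => z t - z' t) s = kdiff x z s - kdiff x z' s.
Proof. by rewrite -sumrB; apply: eq_bigr => i _; rewrite mulrBr. Qed.

Lemma alternatingB z z' : alternating z -> alternating z' ->
  alternating (fun t => z t - z' t).
Proof.
move=> altz altz' p i j s; have [-> ->] := altz p i j s; have [-> ->] := altz' p i j s.
by rewrite opprD subrr.
Qed.

End Koszul.

Section Depth.
Variables (K : fieldType) (n : nat).
Local Notation S := (mpoly K n).
Local Notation x := (fun i : 'I_n => mvar K n i).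
Implicit Types (I : S -> Prop).

(* Vanishing of the j-th Koszul homology of S/I. *)
Definition koszul_exact I (j : nat) := forall z, alternating z ->
  (forall s, (size s).+1 = j -> I (kdiff x z s)) ->
  exists2 w, alternating w & forall s, size s = j -> I (z s - kdiff x w s).

(** Fixed points of negation are the only obstruction to an odd choice; a nonzero one has a nonzero
    coefficient, which forces 2 = 0 in [K]. *)
Lemma two_torsion (v : S) : v = - v -> v = 0 \/ forall c : S, - c = c.
Proof.
move=> vN; case: (pselect (exists w : exps n, mcoef v w != 0)) => [[w vw]|nv].
  right=> c; apply: mpoly_ext => w'; rewrite mcoefN.
  have v2 : mcoef v w + mcoef v w = 0 by rewrite {1}vN mcoefN addNr.
  have : (1 + 1 : K) == 0.
    by rewrite -(mulIr_eq0 _ (mulIf vw)) mulrDl mul1r v2.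
  rewrite addr_eq0 => /eqP e; by rewrite -mulN1r -e mul1r.
left; apply: mpoly_ext => w; rewrite mcoef0; apply/eqP/negPn/negP => vw.
by apply: nv; exists w.
Qed.

(* A choice of lifts commuting with negation turns alternating functions into
   alternating functions. *)
Lemma odd_choice (Q : S -> S -> Prop) :
  (forall v c, Q v c -> Q (- v) (- c)) -> Q 0 0 ->
  exists chi : S -> S, [/\ chi 0 = 0, forall v, chi (- v) = - chi v
     & forall v, (exists c, Q v c) -> Q v (chi v)].
Proof.
move=> QN Q0.
have [lift liftP] : exists lift : S -> S, lift 0 = 0 /\
    forall v, (exists c, Q v c) -> Q v (lift v).
  have /choice[lift H] : forall v, exists c, (exists c, Q v c) -> Q v c.
    by move=> v; case: (pselect (exists c, Q v c)) => [[c Qc]|nQ]; [exists c|exists 0].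
  exists (fun v => if v == 0 then 0 else lift v); rewrite eqxx; split=> // v.
  by case: eqP => [->|_]; [|apply: H].
have [lift0 {}liftP] := liftP.
(* [choose] returns the same element for v and -v, their defining predicates being equal; [lift] is
   used on that representative and extended by sign. *)
pose rep (v : S) := choose [pred w | (w == v) || (w == - v)] v.
have repN v : rep (- v) = rep v.
  rewrite /rep (@eq_choose _ _ [pred w | (w == v) || (w == - v)]); last first.
    by move=> w /=; rewrite opprK orbC.
  by apply: choose_id; rewrite /= eqxx ?orbT.
have repP v : rep v = v \/ rep v = - v.
  have : (rep v == v) || (rep v == - v).
    by apply: (@chooseP _ [pred w | (w == v) || (w == - v)] v); rewrite /= eqxx.
  by case/orP => /eqP ->; [left|right].
exists (fun v => if rep v == v then lift v else - lift (- v)); split=> [|v|v vQ].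
- by rewrite oppr0 lift0 oppr0 if_same.
- rewrite repN opprK; case: (eqVneq v (- v)) => [vN|vN].
    rewrite -vN; case: (two_torsion vN) => [->|cN]; last by rewrite !cN !if_same.
    by rewrite lift0 oppr0 !if_same oppr0.
  case: (repP v) => ->; rewrite eqxx; first by rewrite (negbTE vN).
  by rewrite eq_sym (negbTE vN) opprK.
- case: ifP => _; first exact: liftP.
  rewrite -[X in Q X _]opprK; apply/QN/liftP; have [c Qc] := vQ.
  by exists (- c); apply: QN.
Qed.

Lemma alternating_odd (chi : S -> S) z : chi 0 = 0 -> (forall v, chi (- v) = - chi v) ->
  alternating z -> alternating (fun s : seq 'I_n => chi (z s)).
Proof.
move=> chi0 chiN altz p i j s; have [-> ->] := altz p i j s.
by rewrite chi0 chiN.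
Qed.

Lemma khom_ideal I g z (s : seq 'I_n) : is_ideal I ->
  (forall t, (size t).+1 = size s -> I (z t)) -> I (khom g z s).
Proof.
move=> idI; elim: s z => [|i s IH] z Iz; first exact: ideal0 idI.
apply: (idealB idI); first by apply: (idealM idI); apply: Iz.
by apply: IH => t ts; apply: Iz; rewrite /= ts.
Qed.

Lemma sumI_ideal I f : is_ideal I -> is_ideal (sumI I f).
Proof.
move=> idI; split=> [|a b|a b].
- by exists 0, 0; rewrite mul0r addr0; split=> //; apply: ideal0.
- move=> [c [d [Ic ->]]] [c' [d' [Ic' ->]]]; exists (c + c'), (d + d').
  by rewrite mulrDl addrACA; split=> //; apply: (idealD idI).
- move=> [c [d [Ic ->]]]; exists (a * c), (a * d).
  by rewrite mulrDr mulrA; split=> //; apply: (idealM idI).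
Qed.

(* Multiplication by f = sum_i g_i x_i is null homotopic on the Koszul complex,
   so H_j(S/I) embeds into H_(j+1)(S/(I + f)). *)
Lemma koszul_exact_regular I f j : is_ideal I -> maxideal f ->
  (forall g, I (g * f) -> I g) -> koszul_exact (sumI I f) j.+1 -> koszul_exact I j.
Proof.
move=> idI [g Ef] regf exf z altz dz.
have altgz := alternating_khom g altz.
have dgz s : size s = j -> I (kdiff x (khom g z) s - f * z s).
  move=> sj; rewrite kdiff_khom -Ef addrAC subrr add0r.
  by apply/(idealN idI)/(khom_ideal _ idI) => t ts; apply: dz; rewrite ts.
have [t altt tP] : exists2 t, alternating t &
    forall s, size s = j.+1 -> sumI I f (khom g z s - kdiff x t s).
  apply: exf => // s [sj]; exists (kdiff x (khom g z) s - f * z s), (z s).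
  by split; [apply: dgz|rewrite [z s * f]mulrC subrK].
(* Modulo I, the chain y below has boundary f z and is itself a multiple of f in degree j + 1. Its
   quotient by f, chosen oddly, bounds z because f can be cancelled. *)
pose Q v c := I (v - c * f).
have [||chi [chi0 chiN chiQ]] := @odd_choice Q.
- by move=> v c; rewrite /Q mulNr -opprD; apply: (idealN idI).
- by rewrite /Q mul0r subr0; apply: ideal0 idI.
pose y s := khom g z s - kdiff x t s.
have alty : alternating y by apply: alternatingB => //; apply: alternating_kdiff.
exists (fun s => chi (y s)); first exact: alternating_odd.
move=> s sj; apply: regf.
have yQ i : I (y (i :: s) - chi (y (i :: s)) * f).
  apply: chiQ; have [|a [b [Ia Ey]]] := tP (i :: s); first by rewrite /= sj.
  by exists b; rewrite /Q /y Ey addrK.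
have : I (kdiff x (fun s => y s - chi (y s) * f) s).
  by apply: (ideal_sum idI) => i _; apply: (idealM idI).
rewrite kdiffB /y kdiffB kdiff_kdiff // subr0.
have -> : kdiff x (fun s => chi (y s) * f) s = kdiff x (fun s => chi (y s)) s * f.
  by rewrite mulr_suml; apply: eq_bigr => i _; rewrite mulrA.
move/(idealB idI (dgz _ sj))/(idealN idI); congr (I _).
by rewrite /y; ring.
Qed.

(** Each regular element raises the degree by one, and above degree n the Koszul modules vanish: a
    sequence of more than n indices has a repetition. *)
Lemma koszul_exact_depth I (r : seq S) j : is_ideal I -> regseq I r ->
  (n < j + size r)%N -> koszul_exact I j.
Proof.
elim: r I j => [|f r IH] I j idI /=.
  rewrite addn0 => _ nj z altz _; exists (fun=> 0); first by move=> *; rewrite oppr0.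
  move=> s sj; rewrite /kdiff big1 ?subr0; last by move=> i _; rewrite mulr0.
  rewrite alternating_notuniq //; first exact: ideal0 idI.
  apply/negP => us; have := max_card (mem s); rewrite (card_uniqP us) card_ord.
  by rewrite sj leqNgt nj.
case=> mf regf regr nj; apply: (koszul_exact_regular idI mf regf).
by apply: IH => //; [apply: sumI_ideal|rewrite addSnnS].
Qed.

End Depth.

(** * Multigraded Koszul cycles of a monomial ideal *)

Section MultigradedKoszul.
Variables (K : fieldType) (n : nat).
Local Notation S := (mpoly K n).
Local Notation one := (fun _ : 'I_n => 1 : K).

Definition mcount (s : seq 'I_n) : exps n := [ffun i => count_mem i s].

Lemma mcount_cons i s : mcount (i :: s) = madd (munit i) (mcount s).
Proof. by apply/ffunP => j; rewrite !ffunE. Qed.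

Lemma mcount_perm s t : perm_eq s t -> mcount s = mcount t.
Proof. by move=> /permP st; apply/ffunP => i; rewrite !ffunE st. Qed.

Lemma mcount_swap p i j s : mcount (p ++ i :: j :: s) = mcount (p ++ j :: i :: s).
Proof.
apply: mcount_perm; rewrite perm_cat2l.
by apply/permP => a /=; rewrite addnCA.
Qed.

Lemma mcount_le_uniq (w : exps n) (s : seq 'I_n) :
  uniq s -> all (fun i => 0 < w i)%N s -> mle (mcount s) w.
Proof.
move=> us /allP sw; apply/mleP => i; rewrite ffunE count_uniq_mem //.
by case: (boolP (i \in s)) => // /sw.
Qed.

Lemma khom_vanish (g : 'I_n -> K) k z s :
  (forall t, size t = k -> z t = 0) -> size s = k.+1 -> khom g z s = 0.
Proof.
elim: s k z => [|i s IH] //= k z zk [sk]; rewrite zk // mulr0 sub0r.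
case: k sk zk => [|k] sk zk; first by case: (s) sk => //=; rewrite oppr0.
by rewrite (IH k) ?oppr0 // => t tk; apply: zk; rewrite /= tk.
Qed.

(** Exterior products stay within the variables in [p]. With [p] the variables dividing x^w, this
    ensures that x^w / x^s exists wherever the filling of a cycle is nonzero. *)
Lemma khom_support (p : pred 'I_n) (g : 'I_n -> K) k z s :
  (forall i, g i != 0 -> p i) -> (forall t, size t = k -> z t != 0 -> all p t) ->
  size s = k.+1 -> khom g z s != 0 -> all p s.
Proof.
move=> gp; elim: s k z => [|i s IH] //= k z zp [sk].
case: (boolP (p i)) => pi /= nz.
  case: (eqVneq (g i * z s) 0) => [gz|]; last first.
    by rewrite mulf_eq0 negb_or => /andP[_]; apply: zp.
  case: k zp sk => [|k] zp sk; first by case: (s) sk.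
  apply: (IH k (fun t => z (i :: t))) => //.
    by move=> t tk /zp; rewrite /= tk => /(_ erefl)/andP[].
  by move: nz; rewrite gz sub0r oppr_eq0.
have gi : g i = 0 by apply/eqP; apply: contraR pi => /gp.
move: nz; rewrite gi mul0r sub0r oppr_eq0.
case: k zp sk => [|k] zp sk; first by case: (s) sk => //=; rewrite eqxx.
suff -> : khom g (fun t => z (i :: t)) s = 0 by rewrite eqxx.
apply: khom_vanish sk => t tk; apply/eqP; apply: contraR pi => /zp /=.
by rewrite tk => /(_ erefl)/andP[].
Qed.

(* The multidegree w part of the Koszul complex of I is the simplicial chain
   complex of the set of s with x^w / x^s in I. A cycle b is the boundary in S of
   t s = (h b) s x^w / x^s; the hypothesis moves t into I. *)
Lemma koszul_exact_multidegree (I : S -> Prop) (U : exps n -> Prop) (w : exps n)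
    (b : seq 'I_n -> K) :
  upset U -> (forall f, I f <-> mid U f) -> koszul_exact I 3 ->
  alternating b ->
  (forall s, size s = 2%N -> b s != 0 -> mle (mcount s) w /\ U (msub w (mcount s))) ->
  (forall i, kdiff one b [:: i] = 0) ->
  exists c, [/\ alternating c,
    forall s, size s = 3%N -> c s != 0 -> mle (mcount s) w /\ U (msub w (mcount s)) &
    forall s, size s = 2%N -> kdiff one c s = b s].
Proof.
move=> upU IU exI altb bU db.
case: (pselect (exists2 s, size s = 2%N & b s != 0)) => [[s0 s02 bs0]|nb]; last first.
  exists (fun=> 0); split=> [p i j s|s _|s s2]; rewrite ?oppr0 ?eqxx //.
  rewrite /kdiff big1 => [|i _]; last by rewrite mulr0.
  by apply/esym/eqP/negPn/negP => bs; apply: nb; exists s.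
pose p i := (0 < w i)%N.
have bp t : size t = 2%N -> b t != 0 -> all p t.
  move=> t2 /(bU _ t2)[/mleP tw _]; apply/allP => i it.
  by apply: leq_trans (tw i); rewrite ffunE -has_count has_pred1.
have [i0 pi0] : exists i0, p i0.
  by case: s0 s02 bs0 => [|i s] // s2 /(bp _ s2)/andP[pi _]; exists i.
(* With g the indicator of i0, [khom g] is the cone with apex i0. It fills b in the full simplex on
   the variables dividing x^w, which is why i0 must be one of them. *)
pose g i : K := (i == i0)%:R; pose a := khom g b.
have alta : alternating a by apply: alternating_khom.
have ap s : size s = 3%N -> a s != 0 -> mle (mcount s) w.
  move=> s3 as0; apply: mcount_le_uniq.
    by apply/negPn/negP => /(alternating_notuniq alta)/eqP; apply/negP.
  apply: (khom_support _ bp s3 as0) => i; rewrite /g.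
  by case: (i =P i0) => [->|]; rewrite ?eqxx.
have da s : size s = 2%N -> kdiff one a s = b s.
  move=> s2; rewrite /a kdiff_khom (bigD1 i0) //= /g eqxx mulr1 big1; last first.
    by move=> i /negbTE ->; rewrite mul0r.
  rewrite addr0 mul1r; case: s s2 => [|i [|j [|]]] //= _.
  by rewrite !db !mulr0 !subr0.
pose t s := mconst n (a s) * monomial K (msub w (mcount s)).
have altt : alternating t.
  move=> q i j s; rewrite /t mcount_swap; have [-> ->] := alta q i j s.
  by rewrite mconstN mulNr mconst0 mul0r.
have dt s : size s = 2%N -> kdiff (fun i => mvar K n i) t s =
    mconst n (b s) * monomial K (msub w (mcount s)).
  move=> s2; rewrite -da // /kdiff (big_morph (mconst n) (@mconstD K n) (mconst0 K n)).
  rewrite mulr_suml; apply: eq_bigr => i _; rewrite mul1r /t mulrCA.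
  case: (eqVneq (a (i :: s)) 0) => [->|ais]; first by rewrite mconst0 !mul0r.
  congr (_ * _); rewrite -monomial_unit -monomialD.
  suff -> : madd (munit i) (msub w (mcount (i :: s))) = msub w (mcount s) by [].
  have := ap (i :: s); rewrite /= s2 => /(_ erefl ais) /mleP isw.
  apply/ffunP => j; have := isw j; rewrite mcount_cons !ffunE; lia.
have [v altv tv] : exists2 v, alternating v &
    forall s, size s = 3%N -> I (t s - kdiff (fun i => mvar K n i) v s).
  apply: exI => // s [s2]; rewrite dt // IU => w'.
  rewrite mcoefCM mcoef_monomial; case: (_ =P w') => [<-|_]; last by rewrite mulr0 eqxx.
  by rewrite mulr1 => /(bU _ s2)[].
pose y s := t s - kdiff (fun i => mvar K n i) v s.
have alty : alternating y by apply: alternatingB => //; apply: alternating_kdiff.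
(* This is the coefficient of x^w / x^s in y s. Multiplying by x^s first gives 0 when x^s does not
   divide x^w, where the truncated [msub] would be misleading. *)
exists (fun s => mcoef (monomial K (mcount s) * y s) w); split=> [q i j s|s s3|s s2].
- by rewrite mcount_swap; have [-> ->] := alty q i j s; rewrite mulrN mcoefN mulr0 mcoef0.
- rewrite mcoef_monomialM; case: ifP; rewrite ?eqxx // => sw.
  by have /IU yU := tv _ s3; move/yU.
- have -> : kdiff one (fun s => mcoef (monomial K (mcount s) * y s) w) s
      = mcoef (monomial K (mcount s) * kdiff (fun i => mvar K n i) y s) w.
    rewrite /kdiff mulr_sumr mcoef_sum; apply: eq_bigr => i _.
    by rewrite mul1r mcount_cons monomialD monomial_unit mulrCA mulrA.
  rewrite /y kdiffB kdiff_kdiff // subr0 dt // mulrCA mcoefCM -monomialD.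
  case: (eqVneq (b s) 0) => [->|/(bU _ s2)[sw _]]; first by rewrite mul0r.
  by rewrite mcoef_monomial msubK // eqxx mulr1.
Qed.

End MultigradedKoszul.

(** * Relation trees *)

Section Relations.
Variables (K : fieldType) (n : nat) (T : finType) (a : T -> exps n).
Local Notation one := (fun _ : 'I_n => 1 : K).
Implicit Types (c : T * T -> K) (F : {set T * T}) (V : {set T}) (w : exps n).

(** Boundary map of the directed graph of pairs. In a fixed multidegree the monomial coefficients of
    a syzygy are determined, so only scalars remain. *)
Definition bd c (u : T) : K := \sum_e c e * ((e.1 == u)%:R - (e.2 == u)%:R).

Definition supported F w c :=
  forall e, c e != 0 -> [/\ e \in F, mle (a e.1) w & mle (a e.2) w].

(* The relations e_u - e_v with (u, v) in F generate, in each multidegree, the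
   syzygies of the monomials a u for u in V. *)
Definition generates V F := forall w (b : T -> K),
  (forall u, b u != 0 -> u \in V /\ mle (a u) w) -> \sum_u b u = 0 ->
  exists2 c, supported F w c & forall u, bd c u = b u.

Lemma bdB c c' u : bd (fun e => c e - c' e) u = bd c u - bd c' u.
Proof. by rewrite -sumrB; apply: eq_bigr => e _; rewrite mulrBl. Qed.

Lemma bdN c u : bd (fun e => - c e) u = - bd c u.
Proof. by rewrite -sumrN; apply: eq_bigr => e _; rewrite mulNr. Qed.

Lemma bdZ k c u : bd (fun e => k * c e) u = k * bd c u.
Proof. by rewrite mulr_sumr; apply: eq_bigr => e _; rewrite mulrA. Qed.

Lemma bd0 u : bd (fun=> 0) u = 0.
Proof. by apply: big1 => e _; rewrite mul0r. Qed.

Lemma bd_sum (I : finType) (c : I -> T * T -> K) u :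
  bd (fun e => \sum_i c i e) u = \sum_i bd (c i) u.
Proof. by rewrite exchange_big; apply: eq_bigr => e _; rewrite mulr_suml. Qed.

Lemma eq_bd c c' u : c =1 c' -> bd c u = bd c' u.
Proof. by move=> cc'; apply: eq_bigr => e _; rewrite cc'. Qed.

Lemma sum_indicator (v : T) : \sum_u (v == u)%:R = 1 :> K.
Proof. by rewrite (bigD1 v) //= eqxx big1 ?addr0 // => u; rewrite eq_sym => /negbTE ->. Qed.

Lemma sum_bd c : \sum_u bd c u = 0.
Proof.
rewrite exchange_big big1 // => e _.
by rewrite -mulr_sumr sumrB !sum_indicator subrr mulr0.
Qed.

Lemma bd_support F w c u : supported F w c -> bd c u != 0 -> mle (a u) w.
Proof.
move=> Fc; apply: contraR => uw; apply/eqP/big1 => e _.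
case: (eqVneq (c e) 0) => [->|/Fc[_ e1 e2]]; first by rewrite mul0r.
case: (e.1 =P u) e1 uw => [-> ->//|_ _].
by case: (e.2 =P u) e2 => [-> ->//|_ _ _]; rewrite subrr mulr0.
Qed.

Lemma generates_all : generates setT setT.
Proof.
move=> w b bw sb; case: (pselect (exists u, b u != 0)) => [[u0 bu0]|nb]; last first.
  exists (fun=> 0) => [e|u]; rewrite ?eqxx // bd0.
  by apply/esym/eqP/negPn/negP => bu; apply: nb; exists u.
(* A star centred at u0: the coefficients of b are put on the edges (u, u0), and the contributions
   at u0 add up to the sum of b, which is 0. *)
exists (fun e => (u0 == e.2)%:R * b e.1) => [e|u].
  rewrite mulf_eq0 negb_or => /andP[+ /bw[_ ->]].
  case: (u0 =P e.2) => [<- _|]; rewrite ?eqxx //.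
  by rewrite in_setT; split=> //; have [] := bw _ bu0.
rewrite /bd -(pair_bigA _ (fun u1 u2 => (u0 == u2)%:R * b u1 *
  ((u1 == u)%:R - (u2 == u)%:R))) /=.
rewrite (eq_bigr (fun u1 => b u1 * ((u1 == u)%:R - (u0 == u)%:R))); last first.
  move=> u1 _; rewrite (bigD1 u0) //= eqxx mul1r big1 ?addr0 // => u2.
  by rewrite eq_sym => /negbTE ->; rewrite !mul0r.
under eq_bigr do rewrite mulrBr; rewrite sumrB -mulr_suml sb mul0r subr0.
rewrite (bigD1 u) //= eqxx mulr1 big1 ?addr0 // => u1 /negbTE ->.
by rewrite mulr0.
Qed.

(* Exactness of the multigraded Koszul complex of the ideal I generated by the
   monomials a u: for every w, the simplicial complex of the sets s with
   x^w / x^s in I has no first reduced homology. *)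
Definition koszul_acyclic := forall w (b : seq 'I_n -> K), alternating b ->
  (forall s, size s = 2%N -> b s != 0 ->
     mle (mcount s) w /\ exists u, mle (a u) (msub w (mcount s))) ->
  (forall i, kdiff one b [:: i] = 0) ->
  exists c : seq 'I_n -> K, [/\ alternating c,
    forall s, size s = 3%N -> c s != 0 ->
      mle (mcount s) w /\ exists u, mle (a u) (msub w (mcount s)) &
    forall s, size s = 2%N -> kdiff one c s = b s].

Hypothesis acyclicK : koszul_acyclic.

Section Minimal.
Variable F : {set T * T}.
Hypotheses (genF : generates setT F)
  (minF : forall F', generates setT F' -> (#|F| <= #|F'|)%N).

(** Otherwise w would divide the lcm of the two ends of e. Solving the cycle for e would then
    eliminate e in every multidegree where it occurs, against the minimality of F. *)
Lemma minimal_lcm_lt w c e : supported F w c -> (forall u, bd c u = 0) -> c e != 0 ->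
  exists i, [&& 0 < w i, mle (a e.1) (msub w (munit i)) & mle (a e.2) (msub w (munit i))]%N.
Proof.
move=> Fc dc ce; have [eF e1 e2] := Fc _ ce.
case: (pselect (exists i, (maxn (a e.1 i) (a e.2 i) < w i)%N)) => [[i wi]|nlt].
  exists i; rewrite (leq_ltn_trans _ wi) //=; apply/andP.
  by split; apply/mleP => j; rewrite !ffunE; move/mleP: e1 => /(_ j); move/mleP: e2 => /(_ j);
     case: (i =P j) => [<-|_]; move: wi; rewrite gtn_max; lia.
have lcm_w w' : mle (a e.1) w' -> mle (a e.2) w' -> mle w w'.
  move=> /mleP e1' /mleP e2'; apply/mleP => i; rewrite leqNgt; apply/negP => ww.
  by apply: nlt; exists i; apply: leq_ltn_trans ww; rewrite geq_max e1' e2'.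
have : generates setT (F :\ e).
  move=> w' b bw sb; have [c' Fc' dc'] := genF bw sb.
  case: (eqVneq (c' e) 0) => [c'e|c'e].
    exists c' => // e' c'e'; have [? ? ?] := Fc' _ c'e'; split=> //.
    by rewrite !inE andbC; apply/andP; split=> //; apply: contraNneq c'e' => ->; rewrite c'e.
  exists (fun e' => c' e' - c' e / c e * c e') => [e' ce'|u]; last first.
    by rewrite bdB bdZ dc mulr0 subr0.
  have e'e : e' != e by apply: contraNneq ce' => ->; rewrite divfK ?subrr.
  have [_ e1' e2'] := Fc' _ c'e; have ww' := lcm_w _ e1' e2'.
  rewrite !inE e'e /=; case: (eqVneq (c' e') 0) => [c'e'|/Fc' //].
  have /Fc[-> f1 f2] : c e' != 0.
    by apply: contraNneq ce' => ->; rewrite c'e' mulr0 subrr.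
  by split=> //; apply: mle_trans ww'.
by move/minF; rewrite (cardsD1 e F) eF ltnn.
Qed.

(* A cycle c is cut into chains c_i of degree w - x_i; by acyclicity of the
   Koszul cycles, the boundaries of the c_i are corrected by an alternating
   family d_ij of chains of degree w - x_i - x_j, and c_i - sum_j d_ij is then a
   cycle of degree w - x_i, hence zero by induction on the degree. *)
Lemma minimal_independent w c : supported F w c -> (forall u, bd c u = 0) -> forall e, c e = 0.
Proof.
have [N] := ubnP (\sum_i w i)%N; elim: N w c => // N IH w c wN Fc dc.
(* By [minimal_lcm_lt] every edge of the cycle has a variable that can be divided out of the degree;
   picking one splits c into the [ci i]. *)
pose pk e := [pick i : 'I_n | [&& 0 < w i, mle (a e.1) (msub w (munit i)) &
  mle (a e.2) (msub w (munit i))]%N].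
pose ci i e := if pk e == Some i then c e else 0.
have ciF i : supported F (msub w (munit i)) (ci i).
  move=> e; rewrite /ci /pk; case: pickP => [j /and3P[_ e1 e2]|_]; last by rewrite eqxx.
  rewrite (inj_eq Some_inj); case: (j =P i) => [<-|_]; last by rewrite eqxx.
  by move=> /Fc[].
have ciw i e : ci i e != 0 -> (0 < w i)%N.
  rewrite /ci /pk; case: pickP => [j /and3P[wj _ _]|_]; last by rewrite eqxx.
  by rewrite (inj_eq Some_inj); case: (j =P i) => [<-|_]; rewrite ?eqxx.
have csum e : c e = \sum_i ci i e.
  rewrite /ci; case: (eqVneq (c e) 0) => [->|ce].
    by rewrite big1 // => i _; rewrite if_same.
  have [i0 Hi0] := minimal_lcm_lt Fc dc ce.
  rewrite /pk; case: pickP => [j _|/(_ i0)]; last by rewrite Hi0.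
  rewrite (bigD1 j) //= eqxx big1 ?addr0 // => i /negbTE ij.
  by rewrite (inj_eq Some_inj) eq_sym ij.
pose p i u := (0 < w i)%N && mle (a u) (msub w (munit i)).
pose b i u := bd (ci i) u.
have bp i u : b i u != 0 -> p i u.
  move=> bu; rewrite /p (bd_support (ciF i) bu) andbT lt0n.
  apply: contraNneq bu => wi; rewrite /b (@eq_bd _ (fun=> 0)) ?bd0 // => e.
  by apply/eqP/negPn/negP => /ciw; rewrite wi.
have bsum u : \sum_i b i u = 0.
  by rewrite -bd_sum -[RHS](dc u); apply: eq_bd => e; rewrite [RHS]csum.
pose q u := [pick j | p j u].
(* For fixed u the family b i u has sum 0 over i and lives on the simplex of the i with [p i u]; the
   cone with apex [q u] fills it. *)
pose b2 i j u := (q u == Some j)%:R * b i u - (q u == Some i)%:R * b j u.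
have b2N i j u : b2 i j u = - b2 j i u by rewrite opprB.
have b2_0 i u : b2 i i u = 0 by rewrite /b2 subrr.
have b2sum i u : \sum_j b2 i j u = b i u.
  rewrite sumrB -mulr_sumr bsum mulr0 subr0 -mulr_suml.
  rewrite /q; case: pickP => [j _|nq].
    rewrite (bigD1 j) //= eqxx big1 ?addr0 ?mul1r // => k /negbTE kj.
    by rewrite (inj_eq Some_inj) eq_sym kj.
  rewrite big1 ?mul0r //; apply/esym/eqP/negPn/negP => /bp.
  by rewrite nq.
have b2p i j u : b2 i j u != 0 ->
    mle (mcount [:: i; j]) w && mle (a u) (msub w (mcount [:: i; j])).
  move=> nz; have ij : i != j by apply: contraNneq nz => ->; rewrite b2_0.
  suff /andP[/andP[wi /mleP pi] /andP[wj /mleP pj]] : p i u && p j u.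
    apply/andP; split; apply/mleP => k; move: (pi k) (pj k); rewrite !ffunE /=;
      (case: (eqVneq i k) ij wi => [->|_] ij wi; case: (eqVneq j k) ij wj => [->|_] ij wj;
       by [rewrite eqxx in ij | lia]).
  move: nz; rewrite /b2 /q; case: pickP => [k pku|_]; last by rewrite !mul0r subrr eqxx.
  rewrite !(inj_eq Some_inj); case: (k =P j) pku ij => [->|_] pku ij.
    by rewrite [j == i]eq_sym (negbTE ij) mul0r subr0 mul1r pku andbT => /bp.
  case: (k =P i) pku => [->|_] pku; last by rewrite !mul0r subrr eqxx.
  by rewrite mul0r sub0r mul1r oppr_eq0 pku => /bp.
(* [generates] requires sum 0 over u, which b2 i j may violate. These sums form a Koszul cycle, so
   acyclicity provides gam bounding it. *)
pose beta (s : seq 'I_n) := if s is [:: i; j] then \sum_u b2 i j u else 0.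
have [gam [altg gamp gamd]] : exists c : seq 'I_n -> K, [/\ alternating c,
    forall s, size s = 3%N -> c s != 0 ->
      mle (mcount s) w /\ exists u, mle (a u) (msub w (mcount s)) &
    forall s, size s = 2%N -> kdiff one c s = beta s].
  apply: acyclicK => [r i j s|s|i].
  - case: r => [|x [|y [|? r]]]; case: s => [|z s] /=; rewrite ?oppr0 //.
    by split; [rewrite -sumrN; apply: eq_bigr|apply: big1].
  - case: s => [|i [|j [|]]] //= _ nz.
    have [u bu] : exists u, b2 i j u != 0.
      apply: contrapT => nu; move: nz; rewrite big1 ?eqxx // => u _.
      by apply/eqP/negPn/negP => bu; apply: nu; exists u.
    by case/andP: (b2p _ _ _ bu) => -> ?; split=> //; exists u.
  - rewrite /kdiff /= -[RHS]oppr0 -[in RHS](sum_bd (ci i)) -sumrN.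
    under eq_bigr do rewrite mul1r; rewrite exchange_big; apply: eq_bigr => u _.
    by rewrite -[bd _ _](b2sum i u) -sumrN; apply: eq_bigr => j _.
(* The value of gam at [k; i; j] is placed on one generator dividing x^w / x_k x_i x_j. The choice
   depends only on the degree, so it is symmetric in k, i, j. *)
pose v s := [pick u | mle (a u) (msub w (mcount s))].
pose chi s u : K := (v s == Some u)%:R.
have gchi k i j : \sum_u gam [:: k; i; j] * chi [:: k; i; j] u = gam [:: k; i; j].
  rewrite -mulr_sumr; case: (eqVneq (gam [:: k; i; j]) 0) => [->|nz]; first by rewrite mul0r.
  have [|_ [u0 u0w]] := gamp [:: k; i; j] erefl; first by [].
  rewrite /chi /v; case: pickP => [u1 _|/(_ u0)]; last by rewrite u0w.
  by under eq_bigr do rewrite (inj_eq Some_inj); rewrite sum_indicator mulr1.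
pose b3 i j u := b2 i j u - \sum_k gam [:: k; i; j] * chi [:: k; i; j] u.
have gam_swap k i j : gam [:: k; i; j] = - gam [:: k; j; i] by have [] := altg [:: k] i j [::].
have gam_rot k i j : gam [:: k; i; j] = - gam [:: i; k; j] by have [] := altg [::] k i [:: j].
have gam_diag k i : gam [:: k; i; i] = 0 by have [] := altg [:: k] i i [::].
have chi_swap k i j u : chi [:: k; i; j] u = chi [:: k; j; i] u.
  by rewrite /chi /v (mcount_swap [:: k]).
have chi_rot k i j u : chi [:: k; i; j] u = chi [:: i; k; j] u.
  by rewrite /chi /v (mcount_swap [::]).
have b3p i j u : b3 i j u != 0 ->
    mle (mcount [:: i; j]) w && mle (a u) (msub w (mcount [:: i; j])).
  case: (eqVneq (b2 i j u) 0) => [b20|/b2p //]; rewrite /b3 b20 sub0r oppr_eq0 => nz.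
  have [k] : exists k, gam [:: k; i; j] * chi [:: k; i; j] u != 0.
    apply: contrapT => nk; move: nz; rewrite big1 ?eqxx // => k _.
    by apply/eqP/negPn/negP => ?; apply: nk; exists k.
  rewrite mulf_eq0 negb_or => /andP[/(gamp [:: k; i; j] erefl)[+ _]].
  rewrite mcount_cons => kw; rewrite (mle_trans (mle_addr _ _) kw).
  rewrite /chi /v mcount_cons; case: pickP => [u1 u1w|]; last by rewrite eqxx.
  rewrite (inj_eq Some_inj); case: (u1 =P u) u1w => [-> u1w _|]; last by rewrite eqxx.
  apply: mle_trans u1w _; apply/mleP => l; rewrite !ffunE; lia.
(* The last clause is there because [msub] truncates: if x_i x_j does not divide x^w, there is no
   genuine degree w - x_i - x_j. *)
have d_ex i j : exists d, [/\ supported F (msub w (mcount [:: i; j])) d,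
    forall u, bd d u = b3 i j u & ~~ mle (mcount [:: i; j]) w -> d =1 fun=> 0].
  case: (boolP (mle (mcount [:: i; j]) w)) => ijw; last first.
    exists (fun=> 0); split=> // [e|u]; rewrite ?eqxx // bd0.
    by apply/esym/eqP; apply: contraR ijw => /b3p/andP[].
  have [u /b3p/andP[_ uw]||d dF dd] := @genF (msub w (mcount [:: i; j])) (b3 i j).
  - by split=> //; rewrite in_setT.
  - rewrite sumrB exchange_big /=; under [X in _ - X]eq_bigr do rewrite gchi.
    have := gamd [:: i; j] erefl; rewrite /kdiff /beta => <-.
    by rewrite -sumrB big1 // => k _; rewrite mul1r subrr.
  by exists d.
have [d0 d0P] : exists d0 : 'I_n -> 'I_n -> T * T -> K, forall i j,
    [/\ supported F (msub w (mcount [:: i; j])) (d0 i j),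
    forall u, bd (d0 i j) u = b3 i j u & ~~ mle (mcount [:: i; j]) w -> d0 i j =1 fun=> 0].
  have /choice[d0 d0P] : forall ij : 'I_n * 'I_n, exists d,
    [/\ supported F (msub w (mcount [:: ij.1; ij.2])) d,
    forall u, bd d u = b3 ij.1 ij.2 u & ~~ mle (mcount [:: ij.1; ij.2]) w -> d =1 fun=> 0].
    by move=> ij; apply: d_ex.
  by exists (fun i j => d0 (i, j)) => i j; apply: (d0P (i, j)).
(* Chosen for i < j only and extended by sign, so that the double sum of d vanishes in every
   characteristic. *)
pose d (i j : 'I_n) e := if (i < j)%N then d0 i j e else if (j < i)%N then - d0 j i e else 0.
have mcountC i j : mcount [:: j; i] = mcount [:: i; j] by apply: (mcount_swap [::]).
have b3N i j u : b3 i j u = - b3 j i u.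
  rewrite /b3 opprB b2N addrC; congr (_ + _); rewrite -sumrN; apply: eq_bigr => k _.
  by rewrite gam_swap chi_swap mulNr opprK.
have b30 i u : b3 i i u = 0.
  by rewrite /b3 b2_0 big1 ?subrr // => k _; rewrite gam_diag mul0r.
have dP i j : [/\ supported F (msub w (mcount [:: i; j])) (d i j),
    forall u, bd (d i j) u = b3 i j u & ~~ mle (mcount [:: i; j]) w -> d i j =1 fun=> 0].
  rewrite /d; case: (ltngtP i j) => [_|_|/val_inj ->]; first exact: d0P.
    have [dF dd d00] := d0P j i; split=> [e|u|ijw e].
    - by rewrite oppr_eq0 -mcountC => /dF.
    - by rewrite bdN dd -b3N.
    - by rewrite d00 ?oppr0 // mcountC.
  split=> // [e|u]; first by rewrite eqxx.
  by rewrite bd0 b30.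
have dN i j e : d i j e = - d j i e.
  by rewrite /d; case: (ltngtP i j) => _; rewrite ?opprK ?oppr0.
have d_0 i e : d i i e = 0 by rewrite /d ltnn.
(* The difference of both sides is a cycle of degree w - x_i: in its boundary the corrections by gam
   are antisymmetric in j and k and cancel. *)
have cd i e : ci i e = \sum_j d i j e.
  apply/eqP; rewrite -subr_eq0; apply/eqP.
  case: (posnP (w i)) => wi.
    rewrite (_ : ci i e = 0) ?big1 ?subrr //; last first.
      by apply/eqP/negPn/negP => /ciw; rewrite wi.
    move=> j _; have [_ _ ->] := dP i j => //; apply/negP => /mleP/(_ i).
    by rewrite wi !ffunE /= eqxx.
  apply: (IH (msub w (munit i)) (fun e => ci i e - \sum_j d i j e)) => [|{}e|u].
  - rewrite -ltnS; apply: leq_trans wN; rewrite ltnS (bigD1 i) //= [X in (_ < X)%N](bigD1 i) //=.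
    rewrite !ffunE eqxx -addSn; apply: leq_add; first by rewrite subn1 prednK.
    by apply: leq_sum => j _; rewrite ffunE leq_subr.
  - case: (eqVneq (ci i e) 0) => [->|/ciF //]; rewrite sub0r oppr_eq0 => nz.
    have [j dj] : exists j, d i j e != 0.
      apply: contrapT => nj; move: nz; rewrite big1 ?eqxx // => j _.
      by apply/eqP/negPn/negP => ?; apply: nj; exists j.
    have [/(_ _ dj)[eF e1 e2] _ _] := dP i j.
    have sub : mle (msub w (mcount [:: i; j])) (msub w (munit i)).
      by apply/mleP => k; rewrite !ffunE /= leq_sub2l ?leq_addr.
    by split=> //; apply: mle_trans sub.
  - rewrite bdB bd_sum -/(b i u) -b2sum -sumrB.
    have bdd j : bd (d i j) u = b3 i j u by have [] := dP i j.
    under eq_bigr do rewrite bdd /b3.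
    under eq_bigr do rewrite opprB addrCA subrr addr0.
    apply: sum_antisym => [j k|j]; last by rewrite gam_rot gam_diag oppr0 mul0r.
    by rewrite gam_rot gam_swap gam_rot opprK -mulNr chi_rot chi_swap chi_rot.
move=> e; rewrite csum; under eq_bigr do rewrite cd.
exact: sum_antisym.
Qed.
End Minimal.
End Relations.

Section LeafOrder.
Variables (K : fieldType) (n : nat) (T : finType) (a : T -> exps n).

(* Rank count: the boundary map embeds the free module on F into the kernel of
   the augmentation. *)
Lemma generates_card : (0 < #|T|)%N -> koszul_acyclic K a ->
  exists2 F, generates K a setT F & (#|F| < #|T|)%N.
Proof.
move=> T0 acK.
have : exists k, `[< exists2 F, generates K a setT F & #|F| = k >].
  by exists #|[set: T * T]|; apply/asboolP; exists setT => //; apply: generates_all.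
case/ex_minnP => _ /asboolP[F genF <-] minF.
have {}minF F' : generates K a setT F' -> (#|F| <= #|F'|)%N.
  by move=> genF'; apply: minF; apply/asboolP; exists F'.
exists F => //; pose M : 'M[K]_(#|F|, #|T|) := \matrix_(k, l)
  (((enum_val k).1 == enum_val l)%:R - ((enum_val k).2 == enum_val l)%:R).
have freeM : row_free M.
  apply: inj_row_free => v vM; pose c e := \sum_(k | enum_val k == e) v 0 k.
  have cE k : c (enum_val k) = v 0 k.
    rewrite /c (big_pred1 k) // => k' /=; exact: (inj_eq enum_val_inj).
  (* In the degree of the lcm of all generators every edge is allowed, so a kernel vector of M is a
     cycle to which [minimal_independent] applies. *)
  pose w : exps n := [ffun i => \max_u a u i].
  have aw u : mle (a u) w by apply/mleP => i; rewrite ffunE (bigmax_sup u).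
  have cF : supported a F w c.
    move=> e ce; split=> //; apply: contraNT ce => eF; apply/eqP/big1 => k /eqP ke.
    by rewrite -ke enum_valP in eF.
  apply/rowP => k; rewrite mxE -cE; apply: (minimal_independent acK genF minF cF) => u.
  have /rowP/(_ (enum_rank u)) := vM; rewrite !mxE => <-.
  rewrite /bd (bigID (mem F)) /= [X in _ + X]big1 ?addr0; last first.
    by move=> e eF; rewrite (_ : c e = 0) ?mul0r //; apply/eqP; apply: contraNT eF => /cF[].
  rewrite (reindex_onto enum_val (enum_rank_in (enum_valP k))) /=; last first.
    by move=> e eF; rewrite enum_rankK_in.
  apply: eq_big => [l|l _]; first by rewrite enum_valP enum_valK_in eqxx.
  by rewrite cE mxE enum_rankK.
have /mulmx0_rank_max : M *m (const_mx 1 : 'cV_#|T|) = 0.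
  apply/matrixP => k l; rewrite !mxE.
  under eq_bigr do rewrite !mxE mulr1.
  rewrite sumrB; apply/eqP; rewrite subr_eq0; apply/eqP.
  have sum1 (e : T) : \sum_(l < #|T|) (e == enum_val l)%:R = 1 :> K.
    rewrite (bigD1 (enum_rank e)) //= enum_rankK eqxx big1 ?addr0 // => l' l'e.
    by case: (e =P enum_val l') l'e => // ->; rewrite enum_valK eqxx.
  by rewrite !sum1.
rewrite (eqP freeM); apply: leq_trans; rewrite -addn1 leq_add2l lt0n mxrank_eq0.
apply/eqP => /matrixP/(_ (enum_rank (enum_val (Ordinal T0))) 0).
by rewrite !mxE => /eqP; rewrite oner_eq0.
Qed.

Definition mjoin (u w : 'I_n -> nat) : exps n := [ffun i => maxn (u i) (w i)].

(* Equivalently, each ideal (us') : u with u :: us' a suffix of the list is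
   principal. *)
Fixpoint leaf_order (us : seq (exps n)) : Prop :=
  if us is u :: us' then leaf_order us' /\
    (us' = [::] \/ exists2 v, v \in us' & forall w, w \in us' -> mle v (mjoin u w))
  else True.

Lemma generates_leaf_order (V : {set T}) (F : {set T * T}) : generates K a V F ->
  (forall e, e \in F -> e.1 \in V /\ e.2 \in V) -> (#|F| < #|V|)%N ->
  exists2 s : seq T, s =i V & leaf_order (map a s).
Proof.
have [k] := ubnP #|V|; elim: k V F => // k IH V F Vk genV FV FltV.
pose inc u := [set e in F | (e.1 == u) || (e.2 == u)].
(* Handshake count: otherwise all degrees are at least 2, although they sum to at most 2 |F| < 2
   |V|. *)
have [u uV incu] : exists2 u, u \in V & (#|inc u| <= 1)%N.
  apply: contrapT => nu; have : (\sum_(u in V) 2 <= \sum_(u in V) #|inc u|)%N.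
    by apply: leq_sum => u uV; rewrite ltnNge; apply/negP => ?; apply: nu; exists u.
  rewrite sum_nat_const; under [X in (_ <= X)%N]eq_bigr => u _ do
    rewrite /inc -sum1dep_card big_mkcondr /=.
  rewrite exchange_big /= => le1.
  have le2 : (\sum_(e in F) \sum_(u in V) (if (e.1 == u) || (e.2 == u) then 1 else 0)
      <= \sum_(e in F) 2)%N.
    apply: leq_sum => e _; apply: (@leq_trans (\sum_u ((e.1 == u) + (e.2 == u)))%N).
      rewrite big_mkcond; apply: leq_sum => u _.
      by case: (u \in V) => //; case: (e.1 == u); case: (e.2 == u).
    have s1 (v : T) : (\sum_u (v == u) = 1)%N.
      by rewrite (bigD1 v) //= eqxx big1 // => u; rewrite eq_sym => /negbTE ->.
    by rewrite big_split /= !s1.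
  by have := leq_trans le1 le2; rewrite sum_nat_const leq_pmul2r // leqNgt FltV.
case: (pselect (exists w, w \in V :\ u)) => [[w0 w0V]|nV]; last first.
  exists [:: u]; last by split=> //; left.
  move=> x; rewrite inE; apply/eqP/idP => [->//|xV]; apply/eqP; apply/negPn/negP => xu.
  by apply: nV; exists x; rewrite !inE xu.
have incP e : e \in inc u -> inc u = [set e].
  move=> ei; apply/eqP; rewrite eq_sym eqEcard sub1set ei cards1 /=.
  exact: incu.
(* The syzygy between u and w lives in the degree of their lcm and has coefficient 1 at u, so
   expressing it by F uses a non-loop edge at u. *)
have path w : w \in V :\ u -> exists e, [/\ e \in inc u, e.1 != e.2,
    mle (a e.1) (mjoin (a u) (a w)) & mle (a e.2) (mjoin (a u) (a w))].
  rewrite !inE => /andP[wu wV].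
  have [|| c Fc dc] := genV (mjoin (a u) (a w)) (fun x => (u == x)%:R - (w == x)%:R).
  - move=> x; case: (u =P x) => [<- _|_].
      by split=> //; apply/mleP => i; rewrite ffunE leq_maxl.
    case: (w =P x) => [<- _|_]; last by rewrite subrr eqxx.
    by split=> //; apply/mleP => i; rewrite ffunE leq_maxr.
  - by rewrite sumrB !sum_indicator subrr.
  have := dc u; rewrite eqxx (negbTE wu) subr0 => dcu.
  have [e] : exists e, c e * ((e.1 == u)%:R - (e.2 == u)%:R) != 0.
    apply: contrapT => ne; move: dcu; rewrite /bd big1 => [/esym/eqP|e _].
      by rewrite oner_eq0.
    by apply/eqP/negPn/negP => ?; apply: ne; exists e.
  rewrite mulf_eq0 negb_or => /andP[/Fc[eF e1 e2] eu]; exists e; split=> //.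
    by rewrite inE eF; move: eu; case: (e.1 == u); case: (e.2 == u); rewrite ?subrr ?eqxx.
  by apply: contraNneq eu => ->; rewrite subrr.
have [e0 [e0u e0l _ _]] := path _ w0V; have incE := incP _ e0u.
have := e0u; rewrite inE => /andP[e0F e0i]; have [e01 e02] := FV _ e0F.
have VS : #|V| = #|V :\ u|.+1 by rewrite (cardsD1 u) uV.
have [s sV sl] : exists2 s : seq T, s =i V :\ u & leaf_order (map a s).
  (* A combination with no component at u has coefficient 0 on e0, the only edge at u; hence the
     other edges generate for the remaining vertices. *)
  apply: (IH _ (F :\ e0)).
  - by rewrite -ltnS -VS.
  - move=> w b bV sb; have [|c Fc dc] := genV w b _ sb.
      by move=> x /bV[]; rewrite !inE => /andP[].
    exists c => // e ce; have [eF e1 e2] := Fc _ ce; split=> //.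
    rewrite !inE eF andbT; apply: contraNneq ce => ->.
    have bu : b u = 0 by apply/eqP/negPn/negP => /bV[]; rewrite !inE eqxx.
    move: (dc u); rewrite bu /bd (bigD1 e0) //= big1 ?addr0; last first.
      move=> e' e'0; case: (eqVneq (c e') 0) => [->|/Fc[e'F _ _]]; first by rewrite mul0r.
      have : e' \notin inc u by rewrite incE inE.
      by rewrite inE e'F negb_or => /andP[/negbTE -> /negbTE ->]; rewrite subrr mulr0.
    move/eqP; rewrite mulf_eq0 => /orP[|] //.
    case: (e0.1 =P u) e0i e0l => [->|_] /= e0i.
      by rewrite eq_sym => /negbTE ->; rewrite subr0 oner_eq0.
    by rewrite e0i sub0r oppr_eq0 oner_eq0.
  - move=> e; rewrite !inE => /andP[ee0 eF]; have [-> ->] := FV _ eF.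
    have : e \notin inc u by rewrite incE inE.
    by rewrite inE eF negb_or => /andP[-> ->].
  - move: FltV; rewrite VS (cardsD1 e0) e0F add1n ltnS.
    exact.
exists (u :: s).
  by move=> x; rewrite inE sV !inE; case: (x =P u) => [->|].
split=> //; right.
have [v vV vl] : exists2 v, v \in V :\ u &
    forall w, w \in V :\ u -> mle (a v) (mjoin (a u) (a w)).
  case: (e0.1 =P u) e0i => [eu _|eu /= /eqP eu'].
    exists e0.2 => [|w /path[e [eu' _ _]]]; first by rewrite !inE e02 -eu eq_sym e0l.
    by move: eu'; rewrite incE inE => /eqP ->.
  exists e0.1 => [|w /path[e [eu'' _ + _]]]; first by rewrite !inE e01 andbT; apply/eqP.
  by move: eu''; rewrite incE inE => /eqP ->.
exists (a v); first by apply/map_f; rewrite sV.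
by move=> _ /mapP[w ws ->]; apply: vl; rewrite -sV.
Qed.

End LeafOrder.

Lemma koszul_exact_leaf_order (K : fieldType) n (I : mpoly K n -> Prop) :
  is_monomial_ideal I -> (exists2 f, I f & f <> 0) -> koszul_exact I 3 ->
  exists us : seq (exps n), leaf_order us /\
    forall f, I f <-> mid (fun w => exists2 u, u \in us & mle u w) f.
Proof.
move=> monI [f If f0] exI; have [upI IU] := monomial_ideal_mid monI.
have [us [usI Ius]] := dickson (fun w : exps n => I (monomial K w)).
have us0 : (0 < size us)%N.
  case: us usI Ius => // _ Ius; case: f0; apply: mpoly_ext => w; rewrite mcoef0.
  by apply/eqP/negPn/negP => /((IU f).1 If)/(Ius _)[].
pose a (u : 'I_(size us)) := nth (mzero n) us u.
have genI (w : exps n) : I (monomial K w) <-> exists u, mle (a u) w.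
  split=> [/(Ius _)[u uus uw]|[u /upI]]; last by apply; apply/usI/mem_nth.
  have iu : (index u us < size us)%N by rewrite index_mem.
  by exists (Ordinal iu); rewrite /a nth_index.
have upU : upset (fun w => exists u, mle (a u) w).
  by move=> w w' [u uw] ww'; exists u; apply: mle_trans ww'.
have IU' g : I g <-> mid (fun w => exists u, mle (a u) w) g.
  by rewrite IU; split=> gU w /gU/genI.
have acK : koszul_acyclic K a.
  by move=> w b; apply: (koszul_exact_multidegree upU IU' exI).
have [|F genF Fm] := generates_card _ acK; first by rewrite card_ord.
have [e _||s sT sl] := generates_leaf_order genF; first by rewrite !in_setT.
  by rewrite cardsT.
exists (map a s); split=> // g; rewrite IU'.
split=> gU w /gU => [[u uw]|[_ /mapP[u _ ->] uw]]; last by exists u.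
by exists (a u); rewrite // map_f // sT in_setT.
Qed.

(** * Cleanness *)

Section Clean.
Variables (K : fieldType) (n : nat).
Local Notation S := (mpoly K n).
Implicit Types (I P : S -> Prop) (U : exps n -> Prop) (u v w : exps n) (us : seq (exps n)).

Definition pair_prime P := exists i j, i != j /\ forall f, P f <-> varI [set i; j] f.

(* Carrying the associated primes along makes the absence of embedded primes
   available at every step of the recursion. *)
Definition good I := kclean 0 I /\ forall P, assprime I P -> pair_prime P.

(** No prime (x_i) contains the ideal; in other words, no variable divides all its monomials. *)
Definition height_gt1 U := forall i : 'I_n, exists2 w : exps n, U w & w i = 0%N.

Lemma eq_prime I P : (forall f, P f <-> I f) -> is_prime I -> is_prime P.
Proof.
move=> PI [[idI I1] mulI]; split; last by move=> f g; rewrite !PI; apply: mulI.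
by split; [apply: eq_ideal PI idI|rewrite PI].
Qed.

Lemma pair_minprime U I P : upset U -> (forall f, I f <-> mid U f) -> height_gt1 U ->
  pair_prime P -> subI I P -> minprime I P.
Proof.
move=> upU IU hU [i [j [ij PE]]] IP; split=> //.
  exact: eq_prime PE (varI_prime _ _).
move=> Q prQ IQ QP; have [|A [UA AQ]] := prime_mid_varI upU prQ.
  by move=> f /IU/IQ.
have Aij k : k \in A -> (k == i) || (k == j).
  by move=> /AQ/QP/PE/varI_var; rewrite !inE.
(* Some monomial of the ideal avoids x_l; a variable of A divides it, and this can only be x_k. *)
have inA k l : (forall m, m \in A -> (m == k) || (m == l)) -> k \in A.
  move=> Akl; have [w Uw wl] := hU l.
  have /UA/varI_monomial[m mA wm] := (mid_monomial K U w).2 Uw.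
  by case/orP: (Akl _ mA) => /eqP ml; [rewrite -ml | rewrite ml wl in wm].
have [[idQ _] _] := prQ => f /PE; apply: varI_sub => // k.
rewrite !inE => /orP[]/eqP ->; apply/AQ; first exact: inA Aij.
by apply: (inA _ i) => m /Aij; rewrite orbC.
Qed.

Lemma monomial_inj u v : monomial K u = monomial K v -> u = v.
Proof.
move=> /(congr1 (fun f => mcoef f v)); rewrite !mcoef_monomial eqxx.
by case: eqP => // _ /esym/eqP; rewrite oner_eq0.
Qed.

(* If g f = a + h x with a in I and g f not in I, then I : f = (I : x) : h;
   otherwise I : f = (I + x) : f. *)
Lemma assprime_colon_sum I P x : is_ideal I -> assprime I P ->
  assprime (colon I x) P \/ assprime (sumI I x) P.
Proof.
move=> idI [prP [f Pf]]; have [[idP _] mulP] := prP.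
case: (pselect (exists2 g, sumI I x (g * f) & ~ I (g * f))) => [[g [a [h [Ia E]]] nI]|ng].
  left; split=> //; exists h => k; rewrite /colon.
  have -> : k * h * x = k * (g * f) - k * a by rewrite E; ring.
  split=> [/Pf Ikf|IB].
    apply: (idealB idI); last exact: (idealM idI).
    by rewrite mulrCA; apply: (idealM idI).
  have /Pf/mulP[|/Pf //] : I (k * g * f); last by [].
  rewrite -mulrA -[_ * _](subrK (k * a)); apply: (idealD idI) => //.
  exact: (idealM idI).
right; split=> //; exists f => k; rewrite Pf; split=> [Ikf|].
  by exists (k * f), 0; rewrite mul0r addr0.
by move=> Skf; apply: contrapT => nI; apply: ng; exists k.
Qed.

Lemma munit_self (i : 'I_n) : munit i i = 1%N. Proof. by rewrite ffunE eqxx. Qed.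

Lemma supp_size_munit (i : 'I_n) : (supp_size (munit i) <= 1)%N.
Proof.
rewrite /supp_size -[X in (_ <= X)%N](card1 i); apply/subset_leq_card/subsetP => j.
by rewrite !inE ffunE lt0b eq_sym.
Qed.

(** Here I + x_i = (x_i, u) with x_i not dividing u. A prime over it contains some x_j dividing u,
    so a minimal one is (x_i, x_j), which is minimal over I since no single variable generates a
    prime over I. *)
Lemma good_step U I (i : 'I_n) u : upset U -> (forall f, I f <-> mid U f) ->
  height_gt1 U -> u i = 0%N ->
  (forall w, U w \/ mle (munit i) w <-> mle u w \/ mle (munit i) w) ->
  ~ U (munit i) ->
  good (colon I (monomial K (munit i))) -> good (sumI I (monomial K (munit i))) ->
  good I.
Proof.
move=> upU IU hU ui Uu nUi [clC assC] [clS assS].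
have idI : is_ideal I by apply: eq_ideal IU (mid_ideal _ upU).
have assI P : assprime I P -> pair_prime P.
  by move=> /(assprime_colon_sum (monomial K (munit i)) idI)[/assC|/assS].
split=> //; apply: (@kclean_step _ _ _ _ (munit i)) => //.
- exact: mid_is_monomial_ideal upU IU.
- split=> //; rewrite IU -monomial0 mid_monomial => U0; apply: nUi; apply: upU U0 _.
  by apply/mleP => k; rewrite ffunE.
- move=> P assP; apply: pair_minprime hU (assI _ assP) _ => //.
  by have [_ [f Pf]] := assP => g Ig; apply/Pf/(idealMr idI).
- split; [|by rewrite IU mid_monomial|move=> P [prP SP minP]].
    rewrite -monomial0 => /monomial_inj/ffunP/(_ i).
    by rewrite munit_self ffunE.
  have SE f : sumI I (monomial K (munit i)) f <-> mid (fun w => mle u w \/ mle (munit i) w) f.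
    rewrite (eq_sumI _ _ IU) sumI_mid //.
    by split=> Sf w /Sf/Uu.
  have Pi : P (mvar K n i).
    by apply: SP; rewrite -monomial_unit SE mid_monomial; right; apply: mle_refl.
  have [|j uj Pj] := @prime_monomial _ _ P u prP.
    by apply: SP; rewrite SE mid_monomial; left; apply: mle_refl.
  have ij : i != j by apply/eqP => ij; rewrite -ij ui in uj.
  have [[idP _] _] := prP.
  have varP : subI (varI [set i; j]) P.
    by apply: varI_sub => // k; rewrite !inE => /orP[]/eqP ->.
  have Svar : subI (sumI I (monomial K (munit i))) (varI [set i; j]).
    move=> f /SE Sf w /Sf[/mleP uw|]; first by exists j; rewrite ?inE ?eqxx ?orbT // (leq_trans uj).
    by rewrite munit_le => wi; exists i; rewrite // !inE eqxx.
  apply: pair_minprime hU _ _ => //.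
    exists i, j; split=> // f; split; last exact: varP.
    exact: (minP _ (varI_prime _ _) Svar varP).
  move=> f If; apply: SP; exists f, 0; split=> //.
  by rewrite mul0r addr0.
- exact: supp_size_munit.
Qed.

Lemma good_pair I : pair_prime I -> good I.
Proof.
move=> [i [j [ij IE]]]; have prI := eq_prime IE (varI_prime K [set i; j]).
split; first by apply: kclean_prime => //; apply: mid_is_monomial_ideal IE; apply: varU_upset.
move=> P [[[_ P1] _] [f Pf]]; exists i, j; split=> // g; rewrite Pf -IE.
have [[idI _] mulI] := prI; split=> [/mulI[//|If]|]; last exact: (idealMr idI).
by case: P1; apply/Pf/(idealM idI).
Qed.

(** Induction on the degree of u, cleaning with a variable x_j that divides u: the colon is (u /
    x_j, x_i) and the sum is (x_i, x_j). *)
Lemma good_complete_intersection I (i : 'I_n) u : u i = 0%N -> u != mzero n ->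
  (forall f, I f <-> mid (fun w => mle u w \/ mle (munit i) w) f) -> good I.
Proof.
have [N] := ubnP (\sum_k u k)%N; elim: N u I => // N IH u I uN ui u0 IE.
have [j uj] : exists j, (0 < u j)%N.
  apply: contrapT => nu; move/eqP: u0; apply; apply/ffunP => k; rewrite ffunE.
  by apply/eqP; rewrite -leqn0 leqNgt; apply/negP => uk; apply: nu; exists k.
have ij : i != j by apply/eqP => ij; rewrite -ij ui in uj.
have ju : mle (munit j) u by rewrite munit_le.
have pairE w : mle (munit j) w \/ mle (munit i) w <-> exists2 k, k \in [set i; j] & (0 < w k)%N.
  rewrite !munit_le; split=> [[wk|wk]|[k]]; [exists j|exists i|]; rewrite ?inE ?eqxx ?orbT //.
  by move=> /orP[]/eqP ->; auto.
case: (eqVneq u (munit j)) => [uj1|uj1].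
  apply: good_pair; exists i, j; split=> // f; rewrite IE uj1.
  by split=> If w /If/pairE.
pose U w := mle u w \/ mle (munit i) w.
have upU : upset U.
  by move=> a b [ua|ia] ab; [left; apply: mle_trans ua ab|right; apply: mle_trans ia ab].
(* The roles are exchanged: x_j is the cleaner, and x_i is the monomial that remains modulo x_j. *)
apply: (@good_step U _ j (munit i)) => //.
- move=> k; case: (eqVneq k i) => [->|ki]; first by exists u; [left; apply: mle_refl|].
  by exists (munit i); [right; apply: mle_refl|rewrite ffunE eq_sym (negbTE ki)].
- by rewrite ffunE (negbTE ij).
- move=> w; split=> [[[uw|]|]|[]]; rewrite /U; auto.
  by right; apply: mle_trans uw.
- case=> [/mleP u_le|]; last by rewrite munit_le ffunE eq_sym (negbTE ij).
  case/eqP: uj1; apply/ffunP => k; have := u_le k; rewrite !ffunE.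
  by case: (eqVneq j k) uj => [<-|_] uj /=; lia.
- apply: (IH (msub u (munit j))) => [||| f].
  + rewrite -ltnS; apply: leq_trans uN; rewrite ltnS (bigD1 j) //= [X in (_ < X)%N](bigD1 j) //=.
    rewrite !ffunE eqxx -addSn; apply: leq_add; first by rewrite subn1 prednK.
    by apply: leq_sum => k _; rewrite ffunE leq_subr.
  + by rewrite ffunE ui.
  + apply: contra uj1 => /eqP u1; rewrite -(msubK ju) u1 madd0.
    exact: eqxx.
  + rewrite /colon IE colon_mid; split=> If w /If.
      case=> [/mleP uw|].
        by left; apply/mleP => k; have := uw k; rewrite !ffunE; lia.
      by rewrite !munit_le !ffunE eq_sym (negbTE ij); right.
    case=> [/mleP uw|].
      by left; apply/mleP => k; have := uw k; rewrite !ffunE; lia.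
    by rewrite munit_le; right; rewrite munit_le !ffunE eq_sym (negbTE ij).
- apply: good_pair; exists i, j; split=> // f.
  rewrite (eq_sumI _ _ IE) sumI_mid //; split=> If w /If.
    move=> H; apply/pairE; case: H => [[uw|]|]; auto.
    by left; apply: mle_trans uw.
  by move=> /pairE[]; auto.
Qed.

Definition gens us w := exists2 u, u \in us & mle u w.

Lemma gens_upset us : upset (gens us).
Proof. by move=> v w [u uus uv] vw; exists u => //; apply: mle_trans vw. Qed.

(** Truncated subtraction is monotone and commutes with maxima, so divisibility of an lcm is
    preserved entry by entry. *)
Lemma leaf_order_colon (e : exps n) us : leaf_order us ->
  leaf_order [seq msub (u : exps n) e | u : exps n <- us].
Proof.
elim: us => //= u us IH [/IH lus [->|[v vus vP]]]; split=> //; first by left.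
right; exists (msub v e); first by apply/mapP; exists v.
move=> _ /mapP[w wus ->]; apply/mleP => k; have /mleP/(_ k) := vP _ wus.
by rewrite !ffunE; lia.
Qed.

(* The head u of the list is a leaf, attached at v. If v does not divide u, a
   variable x with deg_x u < deg_x v divides every other monomial and, the gcd
   being 1, not u; hence I + x = (u, x). *)
Lemma leaf_order_good us I : (0 < n)%N -> leaf_order us ->
  (forall f, I f <-> mid (gens us) f) -> height_gt1 (gens us) -> ~ gens us (mzero n) ->
  good I.
Proof.
(* Dropping a redundant entry lowers the length; passing to I : x lowers the total degree, since x
   divides v. *)
move=> n0; have [N] := ubnP (size us + \sum_(u <- us) \sum_i (u : exps n) i)%N.
elim: N us I => // N IH [|u us] I usN.
  by move=> _ _ /(_ (Ordinal n0))[w []].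
move=> [lus leaf] IE hU U0.
(* A single generator would have to avoid every variable and hence be 1. *)
case: leaf => [us0|[v vus vP]].
  exfalso; apply: U0; exists u; first by rewrite inE eqxx.
  apply/mleP => k; have [w [u']] := hU k; rewrite us0 inE => /eqP -> /mleP uw wk.
  by rewrite ffunE -wk.
case: (boolP (mle v u)) => [vu|].
  have genE w : gens (u :: us) w <-> gens us w.
    split=> [[x]|[x xus xw]]; last by exists x; rewrite // inE xus orbT.
    rewrite inE => /orP[/eqP -> uw|xus xw]; last by exists x.
    by exists v => //; apply: mle_trans uw.
  apply: (IH us) => //.
  - by move: usN; rewrite big_cons /=; lia.
  - by move=> f; rewrite IE; split=> If w /If/genE.
  - by move=> k; have [w /genE] := hU k; exists w.
  - by move=> /genE.
rewrite negb_forall => /existsP[j]; rewrite -ltnNge.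
move: (j : 'I_n) => {j} i ui_vi.
have usi w : w \in us -> (v i <= w i)%N.
  by move=> /vP/mleP/(_ i); rewrite ffunE leq_max leqNgt ui_vi.
have ui : u i = 0%N.
  have [w [u' u'us /mleP/(_ i) uw] wi] := hU i; move: u'us uw; rewrite wi inE.
  case/orP=> [/eqP ->|/usi viu']; first by rewrite leqn0 => /eqP.
  by move/(leq_trans viu')/(leq_trans ui_vi).
have u0 : u != mzero n.
  by apply: contra_notN U0 => /eqP u0; exists u; rewrite ?inE ?eqxx // u0 mle_refl.
have genE w : gens (u :: us) w \/ mle (munit i) w <-> mle u w \/ mle (munit i) w.
  split=> [[[x]|]|[]]; [|by auto| |by auto].
    rewrite inE => /orP[/eqP ->|/usi vx /mleP/(_ i) xw]; first by auto.
    by right; rewrite munit_le;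
      exact: leq_trans (leq_ltn_trans (leq0n _) ui_vi) (leq_trans vx xw).
  by left; exists u; rewrite // inE eqxx.
case: (pselect (gens (u :: us) (munit i))) => [xI|xI].
  apply: (good_complete_intersection ui u0) => f; rewrite IE.
  split=> If w /If; first by move=> ?; apply/genE; left.
  by move/genE => [//|]; apply: gens_upset.
apply: (good_step (@gens_upset _) IE hU ui genE xI).
- have colE w : gens [seq msub (x : exps n) (munit i) | x : exps n <- u :: us] w
      <-> gens (u :: us) (madd (munit i) w).
    split=> [[_ /mapP[x xus ->] /mleP xw]|[x xus /mleP xw]].
      by exists x => //; apply/mleP => k; have := xw k; rewrite !ffunE leq_subLR.
    exists (msub x (munit i)); first by apply/mapP; exists x.
    by apply/mleP => k; have := xw k; rewrite !ffunE leq_subLR.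
  apply: (IH [seq msub (x : exps n) (munit i) | x : exps n <- u :: us]).
  + rewrite -ltnS; apply: leq_trans usN; rewrite ltnS size_map ltn_add2l big_map.
    have vus' : v \in u :: us by rewrite inE vus orbT.
    rewrite (big_rem v) //= [X in (_ < X)%N](big_rem v) //=.
    rewrite -addSn leq_add //; last first.
      by apply: leq_sum => x _; apply: leq_sum => k _; rewrite ffunE leq_subr.
    rewrite (bigD1 i) //= [X in (_ < X)%N](bigD1 i) //= -addSn leq_add //.
      by rewrite !ffunE eqxx subn1 prednK // (leq_ltn_trans _ ui_vi).
    by apply: leq_sum => k _; rewrite ffunE leq_subr.
  + by apply: (@leaf_order_colon (munit i) (u :: us)); split=> //; right; exists v.
  + move=> f; rewrite /colon IE colon_mid.
    by split=> If w /If/colE.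
  + move=> k; have [w Uw wk] := hU k; exists w => //.
    by apply/colE/(gens_upset Uw)/mle_addr.
  + by move=> /colE; rewrite madd0.
- apply: (good_complete_intersection ui u0) => f.
  rewrite (eq_sumI _ _ IE) sumI_mid; last exact: gens_upset.
  by split=> If w /If/genE.
Qed.

End Clean.

(** * Height and dimension *)

Section Height.
Variables (K : fieldType) (n : nat).
Local Notation S := (mpoly K n).
Implicit Types (I P : S -> Prop) (U : exps n -> Prop).

Lemma varI_set0 (f : S) : varI set0 f -> f = 0.
Proof.
move=> f0; apply: mpoly_ext => w; rewrite mcoef0; apply/eqP/negPn/negP => /f0[i].
by rewrite inE.
Qed.

Lemma varI_set0_height : ~ height_ge (varI (set0 : {set 'I_n}) : S -> Prop) 2.
Proof.
case=> c [[prc ltc] cE]; have [_ nc] := ltc 1%N isT; apply: nc => f /cE/varI_set0 ->.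
by have [[[]]] := prc 1%N isT.
Qed.

(* A prime properly contained in (x_i) is contained in each power of (x_i). *)
Lemma varI_set1_height (i : 'I_n) : ~ height_ge (varI [set i] : S -> Prop) 2.
Proof.
case=> c [[prc ltc] cE]; have [[[id1 _] mul1] [[id0 _] _]] := (prc 1%N isT, prc 0%N isT).
have [c01 nc10] := ltc 0%N isT; have [c12 nc21] := ltc 1%N isT.
have ci : ~ c 1%N (mvar K n i).
  move=> ci; apply: nc21 => f /cE; apply: varI_sub => // k.
  by rewrite inE => /eqP ->.
suff c1_0 f : c 1%N f -> f = 0 by apply: nc10 => f /c1_0 ->; apply: ideal0 id0.
move=> cf; apply: mpoly_ext => w; rewrite mcoef0.
have [k] := ubnP (w i); elim: k f cf w => // k IH f cf w wk.
have [|g [r [g0 ri Ef]]] := @mid_split K n (fun=> False) (fun w => mle (munit i) w) f.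
  by move=> v /((cE f).1 (c12 _ cf))[j]; rewrite inE munit_le => /eqP ->; right.
have {}g0 : g = 0.
  by apply: mpoly_ext => v; rewrite mcoef0; apply/eqP/negPn/negP => /g0.
have {}Ef : f = mvar K n i *
    \sum_(a <- r) mconst n (mcoef f a) * monomial K (msub a (munit i)).
  rewrite {1}Ef g0 add0r mulr_sumr !big_seq; apply: eq_bigr => v /ri iv.
  by rewrite mulrCA -monomial_unit -monomialD msubK.
move: (\sum_(a <- r) _) Ef => h Ef.
have ch : c 1%N h by have := cf; rewrite Ef => /mul1[/ci|].
rewrite Ef -monomial_unit mcoef_monomialM munit_le.
case: (posnP (w i)) => // wi; apply: IH => //.
by rewrite ffunE munit_self; lia.
Qed.

Lemma height2_gt1 U I : upset U -> (forall f, I f <-> mid U f) ->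
  (forall P, is_prime P -> subI I P -> height_ge P 2) -> height_gt1 U.
Proof.
move=> upU IU hI i; apply: contrapT => nU.
apply: (varI_set1_height (i := i)); apply: hI; first exact: varI_prime.
move=> f /IU Uf w /Uf Uw; exists i; rewrite ?inE // lt0n.
by apply/eqP => wi; apply: nU; exists w.
Qed.

(** The variables in a prime P of height at most 2 over I generate a prime over I. There are at
    least two since I has height 2, and three would give the chain 0, (x_i), (x_i, x_j), P. *)
Lemma height_eq2_pair I : is_monomial_ideal I -> height_eq I 2 ->
  exists i j : 'I_n, i != j /\ subI I (varI [set i; j]).
Proof.
move=> monI [hI [P [prP IP nP]]]; have [upI IU] := monomial_ideal_mid monI.
have [|A [UA AP]] := prime_mid_varI upI prP; first by move=> f /IU/IP.
have IA : subI I (varI A) by move=> f /IU/UA.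
case: (ltngtP #|A| 2%N) => cA.
- case: (posnP #|A|) => [/eqP|A0].
    rewrite cards_eq0 => /eqP A0; case: varI_set0_height; rewrite -A0.
    by apply: hI => //; apply: varI_prime.
  have /cards1P[i Ai] : #|A| == 1%N by rewrite eqn_leq A0 -ltnS cA.
  by case: (@varI_set1_height i); rewrite -Ai; apply: hI => //; apply: varI_prime.
- case: nP; have /card_gt2P[i [j [k [[iA jA kA] [ij jk ki]]]]] := cA.
  pose c (t : nat) : S -> Prop := match t with
    0 => varI set0 | 1 => varI [set i] | 2 => varI [set i; j] | _ => P end.
  have [[idP _] _] := prP.
  exists c; split=> //; split=> [[|[|[|[|]]]]|[|[|[|]]]] //= _; try exact: varI_prime.
  + split; first by apply/varIS; rewrite sub0set.
    by move/varIS/subsetP/(_ i); rewrite !inE eqxx => /(_ isT).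
  + split; first by apply/varIS/subsetP => x; rewrite !inE => ->.
    by move/varIS/subsetP/(_ j); rewrite !inE eqxx orbT eq_sym (negbTE ij) => /(_ isT).
  + split; first by apply: varI_sub => // x; rewrite !inE => /orP[]/eqP ->; apply/AP.
    move/(_ _ ((AP k).1 kA))/varI_var; rewrite !inE (negbTE ki) eq_sym.
    by rewrite (negbTE jk).
- by have /eqP/cards2P[i [j [ij Aij]]] := cA; exists i, j; rewrite -Aij; split.
Qed.

Lemma pair_chain_over I (i j : 'I_n) : i != j -> subI I (varI [set i; j]) ->
  chain_over I (n - 2).
Proof.
move=> ij Iij; pose l := i :: j :: [seq k <- enum 'I_n | k \notin [:: i; j]].
have ul : uniq l.
  rewrite /= !inE negb_or ij !mem_filter !inE !eqxx ?orbT /=.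
  by rewrite filter_uniq ?enum_uniq.
have sl : size l = n.
  rewrite -[RHS]size_enum_ord; apply/perm_size/uniq_perm => //; first exact: enum_uniq.
  move=> k; rewrite mem_enum !inE mem_filter mem_enum !inE andbT negb_or.
  by case: (k == i); case: (k == j).
(* The first two entries of l are i and j, hence the shift by 2; each step adds one more
   variable. *)
exists (fun t => varI [set k in take t.+2 l]); split; last first.
  by move=> f /Iij; apply: (varIS _ _ _).2; apply/subsetP => k; rewrite /l /= take0 !inE.
split=> [t _|t tn]; first exact: varI_prime.
have tl : (t.+2 < size l)%N by rewrite sl; lia.
have := take_uniq t.+3 ul; rewrite (take_nth i tl) rcons_uniq => /andP[nt _].
split; first by apply/varIS/subsetP => k; rewrite !in_set mem_rcons in_cons => ->; rewrite orbT.
move/varIS/subsetP/(_ (nth i l t.+2)); rewrite !in_set mem_rcons in_cons eqxx (negbTE nt).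
by move=> /(_ isT).
Qed.

Lemma dim_quot_ge I d e : dim_quot I d -> chain_over I e -> (e <= d)%N.
Proof.
case=> _ nd [c [[prc ltc] Ic]]; rewrite leqNgt; apply/negP => de; apply: nd.
exists c; split=> //; split=> t td; first by apply: prc; apply: leq_trans de.
by apply: ltc; apply: leq_trans de.
Qed.

End Height.

Theorem theorem5p4 (K : fieldType) (n : nat) (I : mpoly K n -> Prop) :
  is_monomial_ideal I -> CM_quot I -> height_eq I 2 -> kclean 0 I.
Proof.
move=> monI [d [dimI [[r [rd regr]] _]]] hI; have [hI2 _] := hI.
have [upI IU] := monomial_ideal_mid monI.
have [i [j [ij Iij]]] := height_eq2_pair monI hI.
have dn := dim_quot_ge dimI (pair_chain_over ij Iij).
(* Degree 3 is the least that d >= n - 2 allows: the depth lemma requires n < 3 + d. *)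
have exI : koszul_exact I 3 by apply: koszul_exact_depth regr _; [case: monI|rewrite rd; lia].
have [w Uw _] := height2_gt1 upI IU hI2 i.
have [|us [lus IE]] := koszul_exact_leaf_order monI _ exI.
  exists (monomial K w) => // w0; have := mcoef_monomial K w w.
  by rewrite w0 mcoef0 eqxx => /esym/eqP; rewrite oner_eq0.
have n0 : (0 < n)%N by apply: leq_ltn_trans (ltn_ord i).
case: (leaf_order_good n0 lus IE) => //.
  exact: height2_gt1 (@gens_upset _ us) IE hI2.
move=> /(mid_monomial K (gens us))/IE; rewrite monomial0 => I1.
have [[_ nI1] _] := varI_prime K [set i; j].
by apply: nI1; apply: Iij.
Qed.
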